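(* Let $t\ge 2$ be an integer and let $G$ be a (simple) $3$-regular graph with $n=4+2t$ vertices. Then $G$ is potentially $4$-angulable in $K_n$.
   Context: $K_n$ denotes the convex complete graph on $n$ points in convex position in the plane, with straight-line edges. A $4$-angulation of the point set is a plane (non-crossing straight-line) graph on the $n$ points in which every face interior to the convex hull is bounded by a $4$-cycle (so it contains all edges of the convex hull boundary). A geometric graph $H$ on these points admits a $4$-angulation if some $4$-angulation has its edge set contained in $E(H)$. A graph $G$ with $n$ vertices is potentially $4$-angulable in $K_n$ if there is a placement of $G$ in $K_n$ (a bijection from $V(G)$ to the $n$ points, edges drawn as straight segments) such that $K_n-G$, obtained by deleting the edges of the placed copy of $G$ from $K_n$, admits a $4$-angulation. *)

(* Defs.v *)
From mathcomp Require Import all_boot all_order all_algebra.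
From mathcomp Require Import all_classical all_reals all_analysis.

Set Implicit Arguments.
Unset Strict Implicit.
Unset Printing Implicit Defensive.

Import Order.TTheory GRing.Theory Num.Theory.
Import numFieldNormedType.Exports.

Local Open Scope classical_set_scope.
Local Open Scope ring_scope.

Definition simple_graph (V : finType) (e : rel V) : Prop :=
  symmetric e /\ irreflexive e.

Definition regular_graph (V : finType) (d : nat) (e : rel V) : Prop :=
  forall x, #|e x| = d.

Section Plane.
Variable R : realType.
Local Notation plane := 'rV[R]_2.

Definition segment (a b : plane) : set plane :=
  [set (1 - s) *: a + s *: b | s in `[0, 1]].

Definition convex_hull (A : set plane) : set plane :=
  smallest (@convex_set R plane) A.

Definition boundary (A : set plane) : set plane := closure A `\` A^°.

End Plane.

(* A geometric graph has the points [p i] as vertices; it is represented by its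
   adjacency relation [H] on the indices, whose edges are drawn as the segments
   from [p i] to [p j]. *)
Section GeometricGraph.
Variables (R : realType) (n : nat) (p : 'I_n -> 'rV[R]_2).

(* Each point is a vertex of the hull; in particular [p] is injective and no
   three of the points are collinear. *)
Definition convex_position : Prop :=
  forall i, ~ convex_hull (p @` [set j | j != i]) (p i).

Definition edge_segment (i j : 'I_n) : set 'rV[R]_2 := segment (p i) (p j).

Definition drawing (H : rel 'I_n) : set 'rV[R]_2 :=
  range p `|` \bigcup_(ij in [set ij | H ij.1 ij.2]) edge_segment ij.1 ij.2.

Definition plane_graph (H : rel 'I_n) : Prop :=
  forall i j k l, H i j -> H k l -> [set i; j] <> [set k; l] ->
    edge_segment i j `&` edge_segment k l `<=` p @` ([set i; j] `&` [set k; l]).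

Definition faces (H : rel 'I_n) : set (set 'rV[R]_2) :=
  [set connected_component (~` drawing H) z | z in ~` drawing H].

Definition bounded_by_cycle (H : rel 'I_n) (k : nat) (F : set 'rV[R]_2) : Prop :=
  exists c : seq 'I_n, [/\ size c = k, ucycle H c &
    boundary F = \bigcup_(i in [set` c]) edge_segment i (next c i)].

Definition hull_edge (i j : 'I_n) : Prop :=
  i != j /\ edge_segment i j `<=` boundary (convex_hull (range p)).

(* The clause on hull edges is needed: without it, a graph having no face inside
   the hull would satisfy the last clause vacuously. *)
Definition four_angulation (H : rel 'I_n) : Prop :=
  [/\ simple_graph H,
      plane_graph H,
      (forall i j, hull_edge i j -> H i j) &
      (forall F, faces H F -> F `<=` convex_hull (range p) ->
         bounded_by_cycle H 4 F)].

Definition admits_four_angulation (H : rel 'I_n) : Prop :=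
  exists2 Q : rel 'I_n, four_angulation Q & subrel Q H.

Definition placed (V : finType) (G : rel V) (phi : V -> 'I_n) : rel 'I_n :=
  fun i j => [exists x, exists y, [&& G x y, phi x == i & phi y == j]].

Definition complete_minus (V : finType) (G : rel V) (phi : V -> 'I_n) :
    rel 'I_n :=
  fun i j => (i != j) && ~~ placed G phi i j.

Definition potentially_four_angulable (V : finType) (G : rel V) : Prop :=
  exists2 phi : V -> 'I_n, bijective phi &
    admits_four_angulation (complete_minus G phi).

End GeometricGraph.

(* Main.v *)
Require Import Defs.
From mathcomp Require Import all_boot all_order all_algebra.
From mathcomp Require Import all_classical all_reals all_analysis.
From mathcomp Require Import ring lra zify.

(** A quadrangulation of a polygon arises by gluing quadrilateral ears one after
    another. So the statement has a combinatorial half, arranging the vertices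
    of G around a polygon with a quadrangulation none of whose sides is an edge
    of G, and a geometric half, drawing that quadrangulation on the given points.

    Let G have 2m vertices. For m >= 5 the quadrangulation is a fan, in which a
    hub c is joined to every second vertex of the polygon. It can be placed when
    the vertices split into halves A and ~: A such that c and its neighbours lie
    in A and the non-edges between the halves contain a Hamiltonian cycle. Such
    a cycle exists as soon as any edge u v between the halves satisfies
    d(u) + d(v) < m, where d counts the neighbours in the opposite half: a cyclic
    arrangement with the fewest conflicts could otherwise be improved by reversing
    an arc (alternating_cycle_avoiding). A split of smallest cut, among those
    with a vertex that has all its neighbours in its own half, has this property,
    because exchanging u and v must not decrease the cut (balanced_cut).

    Fans do not suffice for eight vertices: the complement of the cube contains
    none. If G has a triangle, a vertex of the triangle can be the hub
    (triangle_avoiding_quadrangulation). Otherwise G contains a 4-cycle, which is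
    joined to the remaining four vertices by a perfect matching, and the
    bipartite complement of that matching contains the ladder with four
    rungs, which quadrangulates the octagon
    (triangle_free_avoiding_quadrangulation).

    For the geometry, sort the points by angle around an extreme one; convex
    position makes every increasing triple turn left (ccw_labelling). Each
    quadrilateral is then an intersection of four half-planes. By induction on
    the ears, any two quadrilaterals are separated by the line through a side of
    one of them (noncrossing), so that edges do not cross, and each point
    strictly inside the polygon is in the interior of a quadrilateral or on a
    side (covering). The interiors are connected, open, and closed relative to
    the complement of the drawing, hence they are exactly the faces inside the
    hull (component_quad_interior), and each is bounded by its four sides. *)

Set Implicit Arguments.
Unset Strict Implicit.
Unset Printing Implicit Defensive.

(** * Quadrangulations of a polygon *)

Section Quadrangulations.

(** A polygon is the list of its vertices in cyclic order. Each step glues the ear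
    a b c d onto the side from a to d. The quadrilaterals are recorded, since both
    the edges and the faces of the drawing are read off from them. *)
Inductive quadrangulation (T : Type) : seq T -> seq (T * T * T * T) -> Prop :=
| quadrangulation_quad a b c d : quadrangulation [:: a; b; c; d] [:: (a, b, c, d)]
| quadrangulation_ear s1 s2 a b c d Qs : quadrangulation (s1 ++ [:: a, d & s2]) Qs ->
    quadrangulation (s1 ++ [:: a, b, c, d & s2]) ((a, b, c, d) :: Qs).

Definition quad_sides (T : Type) (Q : T * T * T * T) : seq (T * T) :=
  let: (a, b, c, d) := Q in [:: (a, b); (b, c); (c, d); (d, a)].

Definition side_rel (T : eqType) (Qs : seq (T * T * T * T)) : rel T :=
  fun x y => has (fun Q => ((x, y) \in quad_sides Q) || ((y, x) \in quad_sides Q)) Qs.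

Arguments side_rel : simpl never.

Lemma side_rel_sym (T : eqType) (Qs : seq (T * T * T * T)) : symmetric (side_rel Qs).
Proof. by move=> x y; apply: eq_has => Q; rewrite orbC. Qed.

Definition map_quad (T U : Type) (f : T -> U) (Q : T * T * T * T) :=
  let: (a, b, c, d) := Q in (f a, f b, f c, f d).

Lemma map_quadrangulation (T U : Type) (f : T -> U) s Qs :
  quadrangulation s Qs -> quadrangulation (map f s) (map (map_quad f) Qs).
Proof.
elim=> [a b c d|s1 s2 a b c d {}Qs _]; first exact: quadrangulation_quad.
by rewrite !map_cat /=; exact: quadrangulation_ear.
Qed.

Lemma quad_sides_map (T U : Type) (f : T -> U) Q :
  quad_sides (map_quad f Q) = [seq (f e.1, f e.2) | e <- quad_sides Q].
Proof. by move: Q => [[[]]]. Qed.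

Lemma cycle_catC (T : Type) (e : rel T) s1 s2 : cycle e (s1 ++ s2) = cycle e (s2 ++ s1).
Proof. by rewrite -rot_size_cat rot_cycle. Qed.

Lemma cycle_side_rel (T : eqType) (s : seq T) Qs :
  quadrangulation s Qs -> cycle (side_rel Qs) s.
Proof.
elim=> [a b c d|s1 s2 a b c d {}Qs _].
  by rewrite /= /side_rel /= !inE !eqxx ?orbT.
rewrite cycle_catC /= => /andP[_ h]; rewrite cycle_catC /=.
have e x y : (x, y) \in quad_sides (a, b, c, d) -> side_rel ((a, b, c, d) :: Qs) x y.
  by move=> h'; rewrite /side_rel [has _ _]/= h'.
rewrite !e ?inE ?eqxx ?orbT //=; apply: (sub_path _ h) => x y.
by rewrite /side_rel [X in _ -> X]/= => ->; rewrite orbT.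
Qed.

Lemma quadrangulation_corners s Qs : quadrangulation s Qs -> sorted ltn s ->
  forall a b c d, (a, b, c, d) \in Qs -> [/\ (a < b)%N, (b < c)%N, (c < d)%N &
    {subset [:: a; b; c; d] <= s}].
Proof.
elim=> [a b c d|s1 s2 a b c d {}Qs _ IH] ss a' b' c' d'; rewrite inE.
  by move: ss => /= /and4P[? ? ? _] /eqP[-> -> -> ->]; split.
have sub : subseq [:: a, d & s2] [:: a, b, c, d & s2].
  rewrite -[[:: a, d & _]]cat1s -[[:: a, b, c, d & _]]cat1s cat_subseq //.
  exact: (suffix_subseq [:: b; c]).
move=> /orP[/eqP[-> -> -> ->]|/IH].
  move/(subseq_sorted ltn_trans): ss => /(_ [:: a; b; c; d]).
  rewrite (_ : subseq _ _); last first.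
    exact/(subseq_trans (prefix_subseq [:: a; b; c; d] s2))/suffix_subseq.
  move=> /(_ isT) /= /and4P[-> -> -> _]; split => // x.
  by rewrite mem_cat !inE => /or4P[] ->; rewrite ?orbT.
have su : subseq (s1 ++ [:: a, d & s2]) (s1 ++ [:: a, b, c, d & s2]) by rewrite cat_subseq.
move=> /(_ (subseq_sorted ltn_trans su ss)) [? ? ? h]; split => // x /h.
exact: (mem_subseq su).
Qed.

(** With vertices numbered along the polygon, no vertex of the remaining polygon
    is strictly between the ends of an ear; this is how later quadrilaterals are
    seen to stay on one side of it. *)
Lemma sorted_ear s1 s2 a b c d : sorted ltn (s1 ++ [:: a, b, c, d & s2]) ->
  [/\ sorted ltn (s1 ++ [:: a, d & s2]), (a < b)%N, (b < c)%N, (c < d)%N &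
   forall x, x \in s1 ++ [:: a, d & s2] -> (x <= a)%N \/ (d <= x)%N].
Proof.
rewrite !(sorted_pairwise ltn_trans) !pairwise_cat.
move=> /and3P[/allrelP h1 -> /= /and4P[/and4P[ab ac ad as2] /and3P[bc bd bs2] /andP[cd cs2] /andP[ds2 ->]]].
rewrite ad as2 ds2 ab bc cd /= !andbT; split => //.
  by apply/allrelP => x y xs; rewrite !inE => /or3P[/eqP->|/eqP->|ys];
    apply: h1; rewrite // !inE ?eqxx ?ys ?orbT.
move=> x; rewrite mem_cat !inE => /or4P[xs|/eqP->|/eqP->|xs]; [left|left|right|right] => //.
  by apply: ltnW; apply: h1; rewrite // inE eqxx.
by move/allP: ds2 => /(_ _ xs)/ltnW.
Qed.

End Quadrangulations.

(** * Adjacent pairs in cyclic sequences *)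

Section CyclicRearrangement.
Variables (T : eqType) (e : rel T).

Fixpoint path_count x s := if s is y :: s' then e x y + path_count y s' else 0.

Definition cycle_count s := if s is x :: s' then e (last x s') x + path_count x s' else 0.

Lemma path_count_cat x s1 s2 :
  path_count x (s1 ++ s2) = path_count x s1 + path_count (last x s1) s2.
Proof. by elim: s1 x => //= y s1 IH x; rewrite IH addnA. Qed.

Lemma cycle_count_cat x s1 y s2 : cycle_count ((x :: s1) ++ y :: s2) =
  e (last y s2) x + path_count x s1 + e (last x s1) y + path_count y s2.
Proof. by rewrite /= path_count_cat last_cat /= !addnA. Qed.

Lemma cycle_count_catC s1 s2 : cycle_count (s1 ++ s2) = cycle_count (s2 ++ s1).
Proof.
case: s1 => [|x s1]; first by rewrite cats0.
case: s2 => [|y s2]; first by rewrite cats0.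
by rewrite !cycle_count_cat; lia.
Qed.

Lemma path_count0 x s : path_count x s = 0 <-> path (fun x y => ~~ e x y) x s.
Proof.
by elim: s x => //= y s IH x; case: (e x y) => //=; rewrite add0n.
Qed.

Lemma cycle_count0 s : cycle_count s = 0 <-> cycle (fun x y => ~~ e x y) s.
Proof.
case: s => //= x s; rewrite rcons_path andbC.
case: (e _ x) => //=; exact: path_count0.
Qed.

Lemma cycle_count_gt0 s : 0 < cycle_count s ->
  exists i x s', rot i s = x :: s' /\ e (last x s') x.
Proof.
case: s => // x s; rewrite /cycle_count.
have [exx _|nexx] := boolP (e (last x s) x); first by exists 0, x, s; rewrite rot0.
rewrite add0n => h.
have [s1 [y [s2 [sE hy]]]] : exists s1 y s2, s = s1 ++ y :: s2 /\ e (last x s1) y.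
  elim: s x h {nexx} => //= y s IH x; have [exy _|_] := boolP (e x y).
    by exists [::], y, s.
  by move=> /IH[s1 [z [s2 [-> hz]]]]; exists (y :: s1), z, s2.
exists (size (x :: s1)), y, (s2 ++ x :: s1).
by rewrite sE -cat_cons rot_size_cat last_cat.
Qed.

Hypothesis e_sym : symmetric e.

Lemma path_count_rev x s : path_count (last x s) (rev (belast x s)) = path_count x s.
Proof.
elim: s x => //= y s IH x; rewrite rev_cons -cats1 path_count_cat IH /= addn0 addnC.
congr (_ + _); rewrite e_sym; congr (nat_of_bool (e _ _)).
by case: s {IH} => //= z s; rewrite rev_cons last_rcons.
Qed.

(** The pairs inside the reversed arc survive because e is symmetric. Compared with
    cycle_count_cat, only the two pairs at the ends of the arc change. *)
Lemma cycle_count_rev x s1 y s2 : cycle_count (rev (x :: s1) ++ y :: s2) =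
  e (last y s2) (last x s1) + path_count x s1 + e x y + path_count y s2.
Proof.
have -> : rev (x :: s1) = last x s1 :: rev (belast x s1) by rewrite lastI rev_rcons.
rewrite cycle_count_cat path_count_rev; congr (_ + _ + nat_of_bool (e _ _) + _).
by case: s1 => //= z s; rewrite rev_cons last_rcons.
Qed.

End CyclicRearrangement.


(** * Alternating Hamiltonian cycles *)

Section AlternatingCycle.
Variables (V : finType) (G : rel V) (A : {set V}) (m : nat).
Hypothesis G_sym : symmetric G.
Local Notation alt := (fun x y : V => (x \in A) != (y \in A)).
Local Notation same := (fun x y : V => (x \in A) == (y \in A)).

Definition cross_degree x := #|[set y | G x y & (x \in A) != (y \in A)]|.

Hypotheses (cardA : #|A| = m) (cardAC : #|~: A| = m).
Hypothesis ore : forall u v, G u v -> (u \in A) != (v \in A) ->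
  cross_degree u + cross_degree v < m.

Lemma alternating_cycle : exists2 s, perm_eq s (enum V) & cycle alt s.
Proof.
have H a b : size a = size b -> {subset a <= A} -> {subset b <= ~: A} ->
   exists2 s, perm_eq s (a ++ b) & forall x, x \notin A -> path alt x s && (last x s \notin A).
  elim: a b => [|x a IH] [|y b] //=.
    by exists [::] => // x ->.
  move=> [sz] ha hb; have [||s ps hs] := IH b sz.
  - by move=> z za; apply: ha; rewrite inE za orbT.
  - by move=> z za; apply: hb; rewrite inE za orbT.
  have xA : x \in A by apply: ha; rewrite mem_head.
  have yA : y \notin A by have := hb y (mem_head _ _); rewrite inE.
  exists [:: x, y & s].
    rewrite perm_cons perm_sym -cat1s perm_catCA /= perm_cons perm_sym //.
  by move=> z zA; rewrite /= xA (negbTE zA) (negbTE yA) /=; exact: hs.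
have [|||s ps hs] := H (enum A) (enum (~: A)).
- by rewrite -!cardE cardA cardAC.
- by move=> x; rewrite mem_enum.
- by move=> x; rewrite mem_enum.
exists s.
  apply: uniq_perm; [rewrite (perm_uniq ps) | exact: enum_uniq |].
    rewrite cat_uniq !enum_uniq andbT /=; apply/hasPn => x; rewrite !mem_enum.
    by rewrite inE.
  by move=> x; rewrite (perm_mem ps) mem_cat !mem_enum !inE orbN.
case: s ps hs => //= x s ps hs; rewrite rcons_path.
have [/existsP[z zA]|] := boolP [exists z, z \notin A]; last first.
  rewrite negb_exists => /forallP h; suff : #|A| = 0.
    move/cards0_eq => A0; by have := h x; rewrite A0 inE.
  by rewrite cardA -cardAC; apply/eqP; rewrite cards_eq0; apply/eqP/setP => z; 
     rewrite !inE; apply/negbTE/h.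
have := hs z zA; rewrite /= => /andP[/andP[zx ->] lA].
by rewrite (negbTE lA) (negbTE zA) in zx *.
Qed.

Lemma alternating_nth x s k : path alt x s -> k <= size s ->
  (nth x (x :: s) k \in A) = (x \in A) (+) odd k.
Proof.
elim: k x s => [|k IH] x [|y s] //=; rewrite ?addbF // => /andP[xy ys] ks.
rewrite (set_nth_default y) /= ?ltnS //; have := IH y s ys ks; rewrite /= => ->.
by move: xy; case: (x \in A); case: (y \in A); case: (odd k).
Qed.

Lemma card_preimage_le (f : nat -> V) (P : pred V) (k : nat) :
  {in gtn k &, injective f} -> #|[set j : 'I_k | P (f j)]| <= #|[set y | P y]|.
Proof.
move=> finj; rewrite -(card_in_imset (f := fun j : 'I_k => f j)); last first.
  by move=> i j _ _ /finj h; apply/val_inj/h; rewrite inE /= ltn_ord.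
by apply/subset_leq_card/fintype.subsetP => y /imsetP[j]; rewrite !inE => Pj ->.
Qed.

(** Let u be the last vertex, so that the pair u x is a conflict. In m places a pair
    w y occurs in which w is on the side of x. Such a place is spoiled by an edge
    u w at most cross_degree u times and by an edge x y at most cross_degree x
    times, so some place is good. Reversing the arc from x to w there trades the
    pairs u x and w y for u w and x y and keeps the alternation. *)
Lemma fewer_conflicts x s : perm_eq (x :: s) (enum V) -> cycle alt (x :: s) -> G (last x s) x ->
  exists2 s', perm_eq s' (enum V) &
    cycle alt s' /\ cycle_count G s' < cycle_count G (x :: s).
Proof.
move=> ps alts Glx; set u := last x s.
have us : uniq (x :: s) by rewrite (perm_uniq ps) enum_uniq.
have szs : size s = (m.*2).-1.
  have := perm_size ps; rewrite /= -cardE -[#|V|](cardsC A) cardA cardAC addnn.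
  by move=> <-.
have m0 : 0 < m by move: (ore Glx); case: (m) => //; move: alts => /= ; rewrite rcons_path => /andP[_ ->] /(_ isT).
move: alts; rewrite /cycle rcons_path => /andP[pa la].
(* Places spoiled by an edge from u, and places spoiled by an edge from x. *)
pose J1 := [set j : 'I_m | G u (nth x (x :: s) j.*2)].
pose J2 := [set j : 'I_m | G x (nth x (x :: s) j.*2.+1)].
have szxs : size (x :: s) = m.*2 by rewrite /= szs; lia.
have hJ1 : #|J1| <= cross_degree u.
  rewrite /J1 (_ : [set _ | _] = [set j : 'I_m | (fun y => G u y && ((u \in A) != (y \in A))) (nth x (x :: s) j.*2)]).
    apply: (@card_preimage_le (fun j => nth x (x :: s) j.*2)
      (fun y => G u y && ((u \in A) != (y \in A)))) => i j; rewrite !inE => im jm /eqP.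
    by rewrite nth_uniq ?szxs ?ltn_double // => /eqP; lia.
  apply/setP => j; rewrite !inE alternating_nth ?odd_double ?addbF ?(la) ?andbT //.
  by rewrite szs; have := ltn_ord j; lia.
have hJ2 : #|J2| <= cross_degree x.
  rewrite /J2 (_ : [set _ | _] = [set j : 'I_m | (fun y => G x y && ((x \in A) != (y \in A))) (nth x (x :: s) j.*2.+1)]).
    apply: (@card_preimage_le (fun j => nth x (x :: s) j.*2.+1)
      (fun y => G x y && ((x \in A) != (y \in A)))) => i j; rewrite !inE => im jm /eqP.
    by rewrite nth_uniq ?szxs //; [move=> /eqP; lia | lia | lia].
  apply/setP => j; rewrite [in RHS]inE [in LHS]inE (alternating_nth pa); last first.
    by rewrite szs; have := ltn_ord j; lia.
  by rewrite /= odd_double addbT; case: (x \in A); rewrite andbT.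
have [j jJ] : exists j, j \notin J1 :|: J2.
  apply/existsP; rewrite -negb_forall; apply/negP => /forallP h.
  have := ore Glx la; rewrite ltnNge => /negP; apply.
  apply: leq_trans (leq_add hJ1 hJ2); apply: leq_trans (leq_card_setU _ _).
  by rewrite -{1}(card_ord m) -cardsT; apply/subset_leq_card/fintype.subsetP.
have jm := ltn_ord j.
have dE : x :: s = (x :: take j.*2 s) ++ nth x s j.*2 :: drop j.*2.+1 s.
  by rewrite /= -drop_nth ?cat_take_drop // szs; lia.
set w := last x (take j.*2 s); set y := nth x s j.*2 in dE.
have wE : w = nth x (x :: s) j.*2.
  rewrite /w (last_nth x) size_take ifT; last by rewrite szs; lia.
  by rewrite -[x :: take _ _]/(take j.*2.+1 (x :: s)) nth_take.
have uE : last y (drop j.*2.+1 s) = u.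
  by have := congr1 (last x) dE; rewrite /= last_cat /= => <-.
move: jJ; rewrite !inE -wE /= -/y negb_or => /andP[nGuw nGxy].
exists (rev (x :: take j.*2 s) ++ y :: drop j.*2.+1 s).
  by rewrite -(permPr ps) dE perm_cat2r perm_rev.
have sameS : symmetric same by move=> a b; rewrite eq_sym.
have wA : (w \in A) = (x \in A).
  by rewrite wE alternating_nth ?odd_double ?addbF // szs; lia.
have yA : (y \in A) = ~~ (x \in A).
  have := @alternating_nth _ _ j.*2.+1 pa; rewrite /= odd_double addbT; apply.
  by rewrite szs; lia.
split.
  have : cycle_count same (x :: s) = 0 by apply/cycle_count0; rewrite /cycle rcons_path pa.
  rewrite dE cycle_count_cat => h; apply/cycle_count0.
  by rewrite cycle_count_rev // uE -/w wA yA; move: h; rewrite uE -/w wA yA.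
rewrite -[X in _ < X]/(cycle_count G (x :: s)); rewrite dE cycle_count_cat cycle_count_rev // uE -/w.
by rewrite (negbTE nGuw) (negbTE nGxy) Glx; lia.
Qed.

(** This is the bipartite form of Ore's theorem, due to Moon and Moser, for the graph
    of non-edges between A and its complement. *)
Lemma alternating_cycle_avoiding : exists2 s, perm_eq s (enum V) &
  cycle alt s /\ cycle (fun x y => ~~ G x y) s.
Proof.
have [s ps alts] := alternating_cycle.
have [k] := ubnP (cycle_count G s).
elim: k s ps alts => // k IH s ps alts; rewrite ltnS => sk.
have [/eqP/cycle_count0 s0|] := boolP (cycle_count G s == 0); first by exists s.
rewrite -lt0n => /cycle_count_gt0[i [x [s' [rs Gx]]]].
have [||//|s'' ps'' [alts'' lt]] := @fewer_conflicts x s'.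
- by rewrite -rs perm_rot.
- by rewrite -rs rot_cycle.
apply: (IH s'') => //; apply: leq_trans lt (leq_trans _ sk).
by rewrite -rs /rot cycle_count_catC cat_take_drop.
Qed.

End AlternatingCycle.

(** * Cuts of cubic graphs *)

Section CubicGraph.
Variables (V : finType) (G : rel V).
Hypotheses (G_sym : symmetric G) (G_irr : irreflexive G).
Hypothesis cubic : forall x, #|G x| = 3.

Definition degree_in (S : {set V}) x := #|[set y in S | G x y]|.

Lemma degree_inE (S : {set V}) x : degree_in S x = \sum_(y in S) G x y.
Proof.
rewrite /degree_in -sum1_card big_mkcond [RHS]big_mkcond /=.
by apply: eq_bigr => y _; rewrite !inE; case: (y \in S); case: (G x y).
Qed.

Lemma degree_in_compl (S : {set V}) x : degree_in S x + degree_in (~: S) x = 3.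
Proof.
have <- : \sum_y G x y = 3.
  rewrite -(cubic x) -sum1_card [RHS]big_mkcond /=.
  by apply: eq_bigr => y _; rewrite -[y \in G x]/(G x y); case: (G x y).
rewrite !degree_inE [RHS](bigID (mem S)) /=; congr (_ + _).
by apply: eq_bigl => y; rewrite inE.
Qed.

Lemma degree_inU1 (S : {set V}) v x : v \notin S -> degree_in (v |: S) x = degree_in S x + G x v.
Proof. by move=> vS; rewrite !degree_inE big_setU1 //= addnC. Qed.

Definition cut (A : {set V}) := \sum_(x in A) degree_in (~: A) x.

(** When v moves to the other side, its edges into A leave the cut and its edges
    out of A enter it. *)
Lemma cut_add (A : {set V}) v : v \notin A ->
  cut (v |: A) + degree_in A v = cut A + degree_in (~: A) v.
Proof.
move=> vA; rewrite /cut big_setU1 //=.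
have CE : ~: A = v |: ~: (v |: A) by apply/finset.setP => x; rewrite !inE; case: eqP => [->|].
have vC : v \notin ~: (v |: A) by rewrite !inE eqxx.
have E x : degree_in (~: A) x = degree_in (~: (v |: A)) x + G x v.
  by rewrite [in LHS]CE degree_inU1.
have -> : \sum_(x in A) degree_in (~: A) x =
    \sum_(x in A) degree_in (~: (v |: A)) x + degree_in A v.
  rewrite (eq_bigr _ (fun x _ => E x)) big_split /= [degree_in A v]degree_inE.
  by congr (_ + _); apply: eq_bigr => x _; rewrite G_sym.
by rewrite [degree_in (~: A) v]E G_irr; lia.
Qed.

(** An edge from u to v stays in the cut although both its ends move, whence the
    correction by G u v. *)
Lemma cut_swap (A : {set V}) u v : u \in A -> v \notin A ->
  cut (v |: A :\ u) + 2 * (degree_in (~: A) u + degree_in A v) = cut A + 6 + 2 * G u v.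
Proof.
move=> uA vA; have uB : u \notin A :\ u by rewrite !inE eqxx.
have vB : v \notin A :\ u by rewrite !inE (negbTE vA) andbF.
have hu := cut_add uB; have hv := cut_add vB.
rewrite finset.setD1K // in hu.
have eu : degree_in A u = degree_in (A :\ u) u.
  by rewrite -[in LHS](finset.setD1K uA) degree_inU1 // G_irr addn0.
have ev : degree_in A v = degree_in (A :\ u) v + G u v.
  by rewrite -[in LHS](finset.setD1K uA) degree_inU1 // G_sym.
have := degree_in_compl A u; have := degree_in_compl A v.
have := degree_in_compl (A :\ u) u; have := degree_in_compl (A :\ u) v.
by rewrite eu ev; lia.
Qed.

Lemma card_swap (A : {set V}) u v : u \in A -> v \notin A -> #|v |: A :\ u| = #|A|.
Proof.
move=> uA vA; rewrite cardsU1 (cardsD1 u A) uA !inE (negbTE vA) andbF //=.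
Qed.

Lemma degree_in_swap0 (A : {set V}) c u v : u \in A -> v \notin A ->
  degree_in (~: A) c = 0 -> ~~ G c u -> degree_in (~: (v |: A :\ u)) c = 0.
Proof.
move=> uA vA c0 ncu; apply/eqP; rewrite cards_eq0; apply/eqP/finset.setP => y; rewrite !inE.
case: (eqVneq y u) => [->|_] /=; first by rewrite (negbTE ncu) andbF.
have := cards0_eq c0 => /finset.setP/(_ y); rewrite !inE.
by case: (y \in A) => /=; [move=> _; rewrite orbT | move=> ->; rewrite andbF].
Qed.

Lemma superset_of_card (A : {set V}) k : #|A| <= k <= #|V| ->
  exists2 B : {set V}, A \subset B & #|B| = k.
Proof.
move=> /andP[]; elim: k => [|k IH]; first by move=> A0 _; exists A => //; apply/eqP; rewrite -leqn0.
rewrite leq_eqVlt => /orP[/eqP kA _|Ak kV]; first by exists A.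
have [B AB kB] := IH Ak (ltnW kV).
have [x xB] : exists x, x \in ~: B.
  by apply/set0Pn; rewrite -card_gt0 cardsCs finset.setCK kB subn_gt0.
exists (x |: B); first exact: fintype.subset_trans AB (finset.subsetUr _ _).
by rewrite cardsU1 kB; move: xB; rewrite inE => ->.
Qed.

(** Take a smallest cut among the sets A of size m that contain a vertex c with no
    neighbour outside. Exchanging the ends of a crossing edge u v does not make the
    cut smaller, which bounds the degree sum by 4, unless u is a neighbour of c,
    for then the exchange spoils c. In that case the sum is at most 2 + 3, and only
    m = 5 remains. There, the exchange of u and v does make the cut smaller, so it
    leaves no vertex without neighbours across; hence its cut is at least 5 and
    that of A at least 7. But A consists of c, its three neighbours and one more
    vertex w, and exchanging w with v shows that w has at most one neighbour
    across, which keeps the cut of A below 7. *)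
Lemma balanced_cut m : #|V| = m.*2 -> 5 <= m -> exists (A : {set V}) c,
  [/\ #|A| = m, c \in A, degree_in (~: A) c = 0 &
   forall u v, u \in A -> v \notin A -> G u v ->
     degree_in (~: A) u + degree_in A v < m].
Proof.
move=> cardV m5.
pose P (A : {set V}) := (#|A| == m) && [exists c in A, degree_in (~: A) c == 0].
have [A0 PA0] : exists A, P A.
  have [c _] : exists c : V, true.
    by have /card_gt0P[c _] : 0 < #|V| by lia; exists c.
  have [|A sub cA] := @superset_of_card (c |: [set y | G c y]) m.
    have := cubic c; rewrite cardsU1 cardsE cardV => ->; case: (_ \notin _); lia.
  exists A; rewrite /P cA eqxx /=; apply/existsP; exists c.
  rewrite (fintype.subsetP sub) ?finset.setU11 //= cards_eq0; apply/eqP/finset.setP => y; rewrite !inE.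
  apply/negbTE/negP => /andP[/negP yA cy]; apply/yA/(fintype.subsetP sub).
  by rewrite !inE cy orbT.
have [A /andP[/eqP cA /existsP[c /andP[cinA /eqP c0]]] Amin] := arg_minnP cut PA0.
exists A, c; split=> // u v uA vA Guv.
have noc y : y \notin A -> ~~ G c y.
  by move=> yA; have := cards0_eq c0 => /finset.setP/(_ y); rewrite !inE yA /= => ->.
have uc : u != c by apply: contraL Guv => /eqP->; exact: noc.
have keep w : w \in A -> w != c -> ~~ G c w -> cut A <= cut (v |: A :\ w).
  move=> wA wc ncw; apply: Amin; rewrite /P card_swap // cA eqxx; apply/existsP; exists c.
  by rewrite degree_in_swap0 // !inE [c == w]eq_sym wc cinA orbT.
have swu := cut_swap uA vA; rewrite Guv in swu.
have [Gcu|nGcu] := boolP (G c u); last by have := keep u uA uc nGcu; lia.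
have du : degree_in (~: A) u <= 2.
  have : 0 < degree_in A u by apply/card_gt0P; exists c; rewrite inE cinA G_sym.
  by have := degree_in_compl A u; lia.
have dv : degree_in A v <= 3 by have := degree_in_compl A v; lia.
rewrite ltnNge; apply/negP => big.
have {m5} m5 : m = 5 by lia.
have nP : ~~ P (v |: A :\ u) by apply/negP => /Amin; lia.
have cut7 : 7 <= cut A.
  suff : 5 <= cut (v |: A :\ u) by lia.
  rewrite -{1}m5 -cA -(card_swap uA vA) -sum1_card; apply: leq_sum => x xA'.
  rewrite lt0n; apply/negP => x0; move/negP: nP; apply.
  by rewrite /P card_swap // cA eqxx; apply/existsP; exists x; rewrite xA'.
pose N := [set y | G c y].
have cN : c \notin N by rewrite inE G_irr.
have NA : N \subset A by apply/fintype.subsetP => y; rewrite inE; apply: contraLR; exact: noc.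
have cardN : #|N| = 3 by rewrite cardsE cubic.
have [w wE] : exists w, A :\: (c |: N) = [set w].
  apply/cards1P; rewrite cardsD (finset.setIidPr _) ?cardsU1 ?cN ?cardN ?cA ?m5 //.
  by rewrite finset.subUset finset.sub1set cinA.
have : w \in A :\: (c |: N) by rewrite wE finset.set11.
rewrite !inE negb_or => /andP[/andP[wc ncw] wA].
have AE : A = w |: (c |: N).
  by rewrite -wE finset.setUC -{1}(finset.setIidPr (_ : c |: N \subset A)) ?finset.setID // finset.subUset finset.sub1set cinA.
have wcN : w \notin c |: N by rewrite !inE negb_or wc.
have cutE : cut A = degree_in (~: A) w + \sum_(a in N) degree_in (~: A) a.
  by rewrite /cut {1}AE !big_setU1 //= c0 add0n.
have dA (a : V) : a \in N -> degree_in (~: A) a + G w a <= 2.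
  move=> aN; have : 1 + G w a <= degree_in A a.
    rewrite AE degree_inU1 // [G w a]G_sym leq_add2r degree_inU1 //.
    by move: aN; rewrite inE G_sym => ->; rewrite addn1.
  by move: (degree_in_compl A a); move: (degree_in A a) (degree_in (~: A) a) (nat_of_bool _) => x y z; clear; lia.
have sumN : \sum_(a in N) degree_in (~: A) a + degree_in A w <= 6.
  have -> : degree_in A w = \sum_(a in N) G w a.
    by rewrite AE degree_inU1 // degree_inU1 // G_irr [G w c]G_sym (negbTE ncw) !addn0 degree_inE.
  rewrite -big_split /= -[6]/(3 * 2) -cardN -sum_nat_const; exact: leq_sum.
move: (cut_swap wA vA) (keep w wA wc ncw) (degree_in_compl A w) sumN cutE cut7 big du dv m5.
move: (G w v) => b; case: b; clear; lia.
Qed.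

(** All of the other side is available to the hub c, so every second vertex of an
    alternating path can be the end of a chord from c, and the ears of the fan
    use up the path two vertices at a time. *)
Lemma fan_quadrangulation (A : {set V}) c : (forall y, (y \in A) != (c \in A) -> ~~ G c y) ->
  forall k v s, size s = k.*2.+2 -> (v \in A) != (c \in A) ->
  path (fun x y => (x \in A) != (y \in A)) v s -> path (fun x y => ~~ G x y) v s ->
  exists2 Qs, quadrangulation [:: c, v & s] Qs &
    forall Q, Q \in Qs -> forall x y, (x, y) \in quad_sides Q -> ~~ G x y.
Proof.
move=> hc; elim=> [|k IH] v [|x [|y s]] //= [].
  move/size0nil-> => vc /and3P[vx xy _] /and3P[nvx nxy _].
  exists [:: (c, v, x, y)]; first exact: quadrangulation_quad.
  move=> Q; rewrite inE => /eqP-> a b; rewrite !inE !xpair_eqE.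
  case/or4P=> /andP[/eqP-> /eqP->] //; first exact: hc.
  rewrite G_sym hc //; move: vc vx xy.
  by case: (v \in A); case: (x \in A); case: (y \in A); case: (c \in A).
move=> sz vc /and3P[vx xy ys] /and3P[nvx nxy nys].
have yc : (y \in A) != (c \in A).
  by move: vc vx xy; case: (v \in A); case: (x \in A); case: (y \in A); case: (c \in A).
have [Qs quadQs sQs] := IH y s sz yc ys nys.
exists ((c, v, x, y) :: Qs); first exact: (@quadrangulation_ear _ [::]).
move=> Q; rewrite inE => /orP[/eqP->|/sQs//] a b; rewrite !inE !xpair_eqE.
by case/or4P=> /andP[/eqP-> /eqP->] //; [|rewrite G_sym]; exact: hc.
Qed.

Definition avoiding_quadrangulation := exists s Qs,
  [/\ perm_eq s (enum V), quadrangulation s Qs &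
    forall Q, Q \in Qs -> forall x y, (x, y) \in quad_sides Q -> ~~ G x y].

(** The alternating cycle of non-edges is the polygon, and the vertex c without
    neighbours across is the hub of the fan. *)
Lemma avoiding_quadrangulation_ge10 m : #|V| = m.*2 -> 5 <= m -> avoiding_quadrangulation.
Proof.
move=> cardV m5; have [A [c [cA cinA c0 ore]]] := balanced_cut cardV m5.
have cAC : #|~: A| = m by rewrite cardsCs finset.setCK cA cardV; lia.
have crossE x : cross_degree G A x = degree_in (if x \in A then ~: A else A) x.
  by apply: eq_card => y; rewrite !inE andbC; case: (x \in A); rewrite ?inE; case: (y \in A).
have [|s ps [alts nGs]] := @alternating_cycle_avoiding V G A m G_sym cA cAC.
  move=> u v Guv; rewrite !crossE.
  case: ifP => uA; case: ifP => vA // _; first by apply: ore => //; rewrite vA.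
  by rewrite addnC; apply: ore => //; rewrite ?uA // G_sym.
have cs : c \in s by rewrite (perm_mem ps) mem_enum.
have [i s' rs] := rot_to cs.
have ps' : perm_eq (c :: s') (enum V) by rewrite -rs perm_rot.
have alts' : cycle (fun x y => (x \in A) != (y \in A)) (c :: s') by rewrite -rs rot_cycle.
have nGs' : cycle (fun x y => ~~ G x y) (c :: s') by rewrite -rs rot_cycle.
have hc y : (y \in A) != (c \in A) -> ~~ G c y.
  rewrite cinA; case yA: (y \in A) => // _.
  by have := cards0_eq c0 => /finset.setP/(_ y); rewrite !inE yA /= => ->.
have sz : size (c :: s') = m.*2 by rewrite (perm_size ps') -cardE cardV.
case: s' rs ps' alts' nGs' sz => [|v s'] rs ps'; first by move=> _ _ /=; lia.
rewrite /cycle !rcons_path => /andP[/= /andP[cv alts'] _] /andP[/= /andP[_ nGs'] _] sz.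
have vc : (v \in A) != (c \in A) by rewrite eq_sym.
have sz' : size s' = m.-2.*2.+2 by move: sz => /=; lia.
have [Qs quadQs hQs] := fan_quadrangulation hc sz' vc alts' nGs'.
by exists [:: c, v & s'], Qs.
Qed.

End CubicGraph.

(** * Cubic graphs on eight vertices *)

Section EightVertices.
Variables (V : finType) (G : rel V).
Hypotheses (G_sym : symmetric G) (G_irr : irreflexive G).
Hypothesis cubic : forall x, #|G x| = 3.
Hypothesis card8 : #|V| = 8.

Lemma perm_enum_uniq (s : seq V) : uniq s -> size s = #|V| -> perm_eq s (enum V).
Proof.
move=> us sz; apply: uniq_perm => //; first exact: enum_uniq.
have [||_ ] // := @uniq_min_size _ s (enum V) us.
  by move=> x _; rewrite mem_enum.
by rewrite -cardE sz.
Qed.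

Lemma in_neighbours x p q r : uniq [:: p; q; r] -> G x p -> G x q -> G x r ->
  forall t, G x t -> t \in [:: p; q; r].
Proof.
move=> u xp xq xr t xt; apply/negPn/negP => nt.
have : #|[:: t; p; q; r]| <= #|G x|.
  apply/subset_leq_card/fintype.subsetP => y; rewrite !inE.
  by case/or4P=> /eqP->.
by rewrite cubic (card_uniqP _) //= nt.
Qed.

Lemma third_neighbour c a b : G c a -> G c b -> exists d, [/\ G c d, d != a & d != b].
Proof.
move=> ca cb; have : 0 < #|[set y | G c y] :\: [set a; b]|.
  rewrite cardsD subn_gt0; apply: leq_ltn_trans (subset_leq_card (finset.subsetIr _ _)) _.
  by rewrite cards2 cardsE cubic; case: (_ != _).
case/card_gt0P=> d; rewrite !inE negb_or => /andP[/andP[da db] cd].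
by exists d.
Qed.

(** With c as the hub, the rest of the polygon alternates between the four vertices
    x, y, z, w not adjacent to c and the neighbours a, b, d of c. Each of a and b
    has at most one neighbour among the four, and x and y are not adjacent to d.
    If a and b exclude the same vertex, then d can come first, otherwise d can be
    put in the middle; eight orders cover all cases. *)
Lemma triangle_avoiding_quadrangulation c a b : G c a -> G c b -> G a b ->
  avoiding_quadrangulation G.
Proof.
move=> ca cb ab; have [d [cd da db]] := third_neighbour ca cb.
have neq x y : G x y -> x != y by apply: contraL => /eqP->; rewrite G_irr.
have nca := neq _ _ ca; have ncb := neq _ _ cb; have ncd := neq _ _ cd; have nab := neq _ _ ab.
pose A := [set c; a; b; d].
have uA : uniq [:: c; a; b; d].
  by rewrite /= !inE !negb_or nca ncb ncd nab eq_sym da eq_sym db.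
have AE t : (t \in A) = (t \in [:: c; a; b; d]) by rewrite !inE !orbA.
have cA : #|A| = 4 by rewrite (eq_card AE) (card_uniqP uA).
have cAC : #|~: A| = 4 by rewrite cardsCs finset.setCK card8 cA.
have [x [y [z [w [uB BE ndx ndy]]]]] : exists x y z w, [/\ uniq [:: x; y; z; w],
    forall t, (t \in ~: A) = (t \in [:: x; y; z; w]), ~~ G d x & ~~ G d y].
  pose e := enum (~: A).
  have pe : perm_eq ([seq t <- e | ~~ G d t] ++ [seq t <- e | ~~ ~~ G d t]) e.
    exact/permPl/perm_filterC.
  have ue : uniq ([seq t <- e | ~~ G d t] ++ [seq t <- e | ~~ ~~ G d t]).
    by rewrite (perm_uniq pe) enum_uniq.
  have se : size ([seq t <- e | ~~ G d t] ++ [seq t <- e | ~~ ~~ G d t]) = 4.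
    by rewrite (perm_size pe) -cardE.
  have ge2 : 2 <= size [seq t <- e | ~~ G d t].
    have : size [seq t <- e | ~~ ~~ G d t] <= 2.
      have -> : size [seq t <- e | ~~ ~~ G d t] = degree_in G (~: A) d.
        rewrite size_filter -sum1_count big_enum_cond /= /degree_in -sum1_card.
        by apply: eq_bigl => t; rewrite !inE negbK.
      have : 0 < degree_in G A d.
        by apply/card_gt0P; exists c; rewrite !inE eqxx G_sym cd.
      move: (degree_in_compl cubic A d); move: (degree_in G A d) (degree_in G _ d).
      by clear; lia.
    by move: se; rewrite size_cat; move: (size _) (size _); clear; lia.
  have nd t : t \in [seq t <- e | ~~ G d t] -> ~~ G d t by rewrite mem_filter => /andP[].
  have me t : (t \in ~: A) = (t \in [seq t <- e | ~~ G d t] ++ [seq t <- e | ~~ ~~ G d t]).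
    by rewrite (perm_mem pe) mem_enum.
  move: ue se ge2 nd me {pe}.
  move: [seq t <- e | ~~ G d t] [seq t <- e | ~~ ~~ G d t] => [|x [|y r]] l2 //=.
  move: (r ++ l2) => [|z [|w [|? ?]]] // ul _ _ nd me.
  by exists x, y, z, w; split=> //; apply: nd; rewrite !inE eqxx ?orbT.
have notin t : t \in [:: x; y; z; w] -> [/\ t != c, t != a, t != b & t != d].
  by rewrite -BE !inE !negb_or -!andbA => /and4P[].
have cover t : t \in [:: c; a; b; d; x; y; z; w].
  by have := BE t; rewrite !inE -!orbA; case: (t == c); case: (t == a); case: (t == b); case: (t == d).
have uV : uniq ([:: c; a; b; d] ++ [:: x; y; z; w]).
  rewrite cat_uniq uA uB andbT; apply/hasPn => t /notin[]; rewrite !inE.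
  by move=> /negbTE-> /negbTE-> /negbTE-> /negbTE->.
have Gc t : G c t -> t \in [:: a; b; d].
  by apply: in_neighbours; rewrite // /= !inE negb_or nab eq_sym da eq_sym db.
have fan e1 e2 e3 b1 b2 b3 b4 :
    perm_eq [:: c; b1; e1; b2; e2; b3; e3; b4] [:: c; a; b; d; x; y; z; w] ->
    perm_eq [:: e1; e2; e3] [:: a; b; d] -> perm_eq [:: b1; b2; b3; b4] [:: x; y; z; w] ->
    [&& ~~ G e1 b1, ~~ G e1 b2, ~~ G e2 b2, ~~ G e2 b3, ~~ G e3 b3 & ~~ G e3 b4] ->
    avoiding_quadrangulation G.
  move=> p8 pe pb /and5P[n1 n2 n3 n4 /andP[n5 n6]].
  have eA i : i \in [:: e1; e2; e3] -> i \in A.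
    by rewrite (perm_mem pe) AE => h; rewrite inE h orbT.
  have bA i : i \in [:: b1; b2; b3; b4] -> (i \in A) = false.
    by rewrite (perm_mem pb) -BE finset.in_setC => /negbTE.
  have cinA : c \in A by rewrite AE mem_head.
  have hc t : (t \in A) != (c \in A) -> ~~ G c t.
    rewrite cinA; apply: contraNN => /Gc h; rewrite AE inE h orbT //.
  have [] := @fan_quadrangulation V G G_sym A c hc 2 b1 [:: e1; b2; e2; b3; e3; b4] erefl.
  - by rewrite cinA bA ?mem_head.
  - by rewrite /= (bA b1) ?(bA b2) ?(bA b3) ?(bA b4) ?(eA e1) ?(eA e2) ?(eA e3) // !inE eqxx ?orbT.
  - by rewrite /= ![G b1 _]G_sym ![G b2 _]G_sym ![G b3 _]G_sym n1 n2 n3 n4 n5 n6.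
  move=> Qs quadQs hQs; exists [:: c; b1; e1; b2; e2; b3; e3; b4], Qs; split => //.
  by rewrite (permPl p8); apply: perm_enum_uniq; rewrite ?card8.
have one p q e t t' : uniq [:: p; q; t] -> G e p -> G e q -> t' != p -> t' != q -> t' != t ->
    ~~ (G e t && G e t').
  move=> u ep eq h1 h2 h3; apply/negP => /andP[et] /(in_neighbours u ep eq et).
  by rewrite !inE (negbTE h1) (negbTE h2) (negbTE h3).
have {}neq : [/\ a != c, b != c, d != c, b != a & d != a /\ d != b].
  by split; rewrite // eq_sym.
case: neq => nac nbc ndc nba [nda ndb].
have ac : G a c by rewrite G_sym.
have bc : G b c by rewrite G_sym.
have dc : G d c by rewrite G_sym.
have ba : G b a by rewrite G_sym.
have onea t t' : t \in [:: x; y; z; w] -> t' \in [:: x; y; z; w] -> t != t' -> ~~ (G a t && G a t').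
  move=> /notin[? ? ? ?] /notin[? ? ? ?] tt'; apply: (one c b) => //; last by rewrite eq_sym.
  by rewrite /= !inE negb_or eq_sym nbc andbT /= ![_ == t]eq_sym; apply/andP.
have oneb t t' : t \in [:: x; y; z; w] -> t' \in [:: x; y; z; w] -> t != t' -> ~~ (G b t && G b t').
  move=> /notin[? ? ? ?] /notin[? ? ? ?] tt'; apply: (one c a) => //; last by rewrite eq_sym.
  by rewrite /= !inE negb_or eq_sym nac andbT /= ![_ == t]eq_sym; apply/andP.
(* A vertex t joined to a, b and d has no further neighbour; since a and b have
   no second neighbour among the four either, only y and t' are left for x. *)
have full t t' : perm_eq [:: t; t'] [:: z; w] -> ~~ [&& G a t, G b t & G d t].
  move=> ptt; apply/negP => /and3P[at' bt dt].
  have tB : t \in [:: x; y; z; w].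
    by rewrite -[[:: x; y; z; w]]/([:: x; y] ++ [:: z; w]) mem_cat -(perm_mem ptt) mem_head orbT.
  have [ntc nta ntb ntd] := notin t tB.
  have xB : x \in [:: x; y; z; w] by exact: mem_head.
  have nxt : x != t.
    have /hasPn h : ~~ has (mem [:: x; y]) [:: z; w].
      by move: uB; rewrite -[[:: x; y; z; w]]/([:: x; y] ++ [:: z; w]) cat_uniq => /and3P[].
    by have := h t; rewrite -(perm_mem ptt) mem_head !inE => /(_ isT); rewrite negb_or eq_sym => /andP[].
  have sub : #|G x| <= #|[:: y; t']|.
    apply/subset_leq_card/fintype.subsetP => r; rewrite -[r \in G x]/(G x r) => xr.
    have := cover r; rewrite -[[:: c; _; _; _; _; _; _; _]]/([:: c; a; b; d; x; y] ++ [:: z; w]).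
    rewrite mem_cat -(perm_mem ptt) !inE.
    case/orP=> [/or4P[/eqP e|/eqP e|/eqP e|/or3P[/eqP e|/eqP e|->//]]|/orP[/eqP e|->]]; last (by rewrite orbT); exfalso; move: xr; rewrite e => xr {r e}.
    + have /notin[] := xB; rewrite G_sym in xr; move: (Gc _ xr).
      by rewrite !inE => /or3P[] ->.
    + by have := onea _ _ tB xB; rewrite eq_sym nxt at' [G a x]G_sym xr => /(_ isT).
    + by have := oneb _ _ tB xB; rewrite eq_sym nxt bt [G b x]G_sym xr => /(_ isT).
    + by move: ndx; rewrite G_sym xr.
    + by rewrite G_irr in xr.
    + have u : uniq [:: a; b; d] by rewrite /= !inE negb_or nab eq_sym nda eq_sym ndb.
      move: xr; rewrite G_sym => xr.
      have := in_neighbours u _ _ _ xr; rewrite ![G t _]G_sym => /(_ at' bt dt).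
      have [xc xa xb xd] := notin x xB.
      by rewrite !inE (negbTE xa) (negbTE xb) (negbTE xd).
  have := leq_trans sub (card_size _); rewrite cubic //.
have fz := full z w (perm_refl _).
have fw : ~~ [&& G a w, G b w & G d w] by apply: (full w z); rewrite perm_sym (perm_catC [:: z]).
move: (uB); rewrite /= !inE !negb_or => /and4P[/and3P[xy xz xw] /andP[yz yw] zw _].
have m4 : [/\ x \in [:: x; y; z; w], y \in [:: x; y; z; w], z \in [:: x; y; z; w] & w \in [:: x; y; z; w]].
  by rewrite !inE !eqxx !orbT.
case: m4 => mx my mz mw.
(* Orders with d in the middle, then orders with d first. *)
have key : [|| [&& ~~ G a z, ~~ G a x, ~~ G d x, ~~ G d y, ~~ G b y & ~~ G b w],
    [&& ~~ G a w, ~~ G a x, ~~ G d x, ~~ G d y, ~~ G b y & ~~ G b z],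
    [&& ~~ G a z, ~~ G a y, ~~ G d y, ~~ G d x, ~~ G b x & ~~ G b w],
    [&& ~~ G a w, ~~ G a y, ~~ G d y, ~~ G d x, ~~ G b x & ~~ G b z],
    [&& ~~ G d x, ~~ G d y, ~~ G a y, ~~ G a z, ~~ G b z & ~~ G b w],
    [&& ~~ G d y, ~~ G d x, ~~ G a x, ~~ G a z, ~~ G b z & ~~ G b w],
    [&& ~~ G d z, ~~ G d x, ~~ G a x, ~~ G a y, ~~ G b y & ~~ G b w] |
    [&& ~~ G d w, ~~ G d x, ~~ G a x, ~~ G a y, ~~ G b y & ~~ G b z]].
  have := oneb _ _ mx my xy; have := oneb _ _ mx mz xz; have := oneb _ _ mx mw xw.
  have := oneb _ _ my mz yz; have := oneb _ _ my mw yw; have := oneb _ _ mz mw zw.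
  have := onea _ _ mx my xy; have := onea _ _ mx mz xz; have := onea _ _ mx mw xw.
  have := onea _ _ my mz yz; have := onea _ _ my mw yw; have := onea _ _ mz mw zw.
  move: fz fw; rewrite ndx ndy /=.
  move: (G a x) (G a y) (G a z) (G a w) (G b x) (G b y) (G b z) (G b w) (G d z) (G d w).
  clear; case=> [] [] //= [] //= [] //= [] //= [] //= [] //= [] //= [] //= [] //=.
move: key; do 7?[case/orP]; apply: fan; apply/permP => P /=;
  move: (nat_of_bool _) (nat_of_bool _) (nat_of_bool _); clear; lia.
Qed.

Lemma sum_degree_in_sym (A B : {set V}) :
  \sum_(x in A) degree_in G B x = \sum_(y in B) degree_in G A y.
Proof.
rewrite (eq_bigr _ (fun x _ => degree_inE G B x)) exchange_big.
apply: eq_bigr => y _; rewrite degree_inE.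
by apply: eq_bigr => x _; rewrite G_sym.
Qed.

(** Without triangles, the neighbourhood N of a vertex c sends six edges to the four vertices that are
    neither c nor in N, so one of these has two neighbours in N. *)
Lemma four_cycle : (forall x y z, G x y -> G y z -> ~~ G x z) ->
  exists c y a b, [/\ c != y, a != b, G c a && G c b & G y a && G y b].
Proof.
move=> tf; have /card_gt0P[c _] : 0 < #|V| by rewrite card8.
pose N := [set y | G c y].
have cardN : #|N| = 3 by rewrite cardsE cubic.
have cN : c \notin N by rewrite inE G_irr.
pose B := ~: (c |: N).
have cardB : #|B| = 4 by rewrite cardsCs finset.setCK cardsU1 cN cardN card8.
suff [y yB Ny] : exists2 y, y \in B & 1 < degree_in G N y.
  have /card_gt1P[a [b [aN bN ab]]] := Ny.
  exists c, y, a, b; move: yB aN bN; rewrite !inE negb_or => /andP[yc _].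
  by move=> /andP[ca ya] /andP[cb yb]; rewrite eq_sym; split; rewrite ?ca ?cb ?ya ?yb.
apply/exists_inP; rewrite -[[exists _ in _, _]]negbK negb_exists_in; apply/negP => /forall_inP h.
have : \sum_(y in B) degree_in G N y <= 4.
  by rewrite -cardB -sum1_card; apply: leq_sum => y /h; rewrite -leqNgt.
rewrite sum_degree_in_sym (eq_bigr (fun=> 2)); first by rewrite sum_nat_const cardN.
move=> a aN; have := degree_in_compl cubic (c |: N) a; rewrite -/B degree_inU1 //.
have -> : degree_in G N a = 0.
  apply/eqP; rewrite cards_eq0; apply/eqP/finset.setP => b; rewrite !inE.
  apply/negbTE/negP => /andP[cb ab]; move: aN; rewrite inE => ca.
  by have := tf _ _ _ ca ab; rewrite cb.
by move: aN; rewrite inE G_sym => -> [].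
Qed.

(** Each vertex x of a 4-cycle A has one neighbour f x outside A. The four vertices
    outside receive four edges from A and each of them at least one: a vertex t
    receiving none would be adjacent to the other three, which would then have two
    neighbours in A each. So f is injective, and x is not adjacent to f x' for
    x' != x. The ladder with rungs a (f y), c (f b), y (f a) and b (f c) uses only
    such pairs. *)
Lemma triangle_free_avoiding_quadrangulation : (forall x y z, G x y -> G y z -> ~~ G x z) ->
  avoiding_quadrangulation G.
Proof.
move=> tf; have [c [y [a [b [cy ab /andP[ca cb] /andP[ya yb]]]]]] := four_cycle tf.
have neq u v : G u v -> u != v by apply: contraL => /eqP->; rewrite G_irr.
have nca := neq _ _ ca; have ncb := neq _ _ cb; have nya := neq _ _ ya; have nyb := neq _ _ yb.
have ncy : G c y = false.
  by apply/negbTE; have := tf _ _ _ ca; rewrite G_sym in ya; apply.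
have nGab : G a b = false.
  by apply/negbTE; move: (tf a c b); rewrite [G a c]G_sym; apply.
pose A := c |: (y |: (a |: [set b])).
have aN : a \notin [set b] by rewrite inE.
have yN : y \notin a |: [set b] by rewrite !inE negb_or nya.
have cN : c \notin y |: (a |: [set b]) by rewrite !inE !negb_or cy nca.
have dA (x : V) : degree_in G A x = G x b + G x a + G x y + G x c.
  by rewrite /A !degree_inU1 // degree_inE big_set1.
have xA x : x \in A -> degree_in G (~: A) x = 1.
  have : x \in A -> degree_in G A x = 2.
    rewrite dA !inE => /or4P[] /eqP->; rewrite ?G_irr ?ncy ?nGab ?ca ?cb ?ya ?yb //.
    - by rewrite [G y c]G_sym ncy.
    - by rewrite [G a y]G_sym [G a c]G_sym ya ca.
    - by rewrite [G b a]G_sym [G b y]G_sym [G b c]G_sym nGab yb cb.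
  by move=> h /h; have := degree_in_compl cubic A x => + h2; rewrite h2 => -[].
have cardA : #|A| = 4 by rewrite /A !cardsU1 cards1 !inE !negb_or cy nca ncb nya nyb ab.
have cardAC : #|~: A| = 4 by rewrite cardsCs finset.setCK card8 cardA.
have total : \sum_(t in ~: A) degree_in G A t = 4.
  by rewrite sum_degree_in_sym (eq_bigr (fun=> 1)) // sum_nat_const cardA.
have cardD t : t \in ~: A -> #|~: A :\ t| = 3.
  by move=> tA; have := cardsD1 t (~: A); rewrite cardAC tA add1n => -[].
have ge1 t : t \in ~: A -> 0 < degree_in G A t.
  move=> tA; rewrite lt0n; apply/negP => /eqP t0.
  have dt : degree_in G (~: A) t = 3 by have := degree_in_compl cubic A t; rewrite t0.
  have tE : [set r in ~: A | G t r] = ~: A :\ t.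
    apply/eqP; rewrite eqEcard; apply/andP; split.
      apply/fintype.subsetP => r; rewrite !inE => /andP[-> tr].
      by rewrite eq_sym (neq _ _ tr).
    by rewrite cardD // [X in _ <= X]dt.
  have two r : r \in ~: A :\ t -> 2 <= degree_in G A r.
    rewrite -tE inE => /andP[rA tr].
    suff : degree_in G (~: A) r <= 1.
      move: (degree_in_compl cubic A r); move: (degree_in G A r) (degree_in G _ r).
      by clear; lia.
    rewrite -(cards1 t); apply/subset_leq_card/fintype.subsetP => r'.
    rewrite inE => /andP[rA' rr']; rewrite inE; apply/negPn/negP => nt.
    have : r' \in ~: A :\ t by rewrite finset.in_setD1 nt.
    rewrite -tE inE => /andP[_ tr'].
    by have := tf _ _ _ tr rr'; rewrite tr'.
  move: total; rewrite (big_setD1 t) //= t0 add0n => total.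
  have : \sum_(r in ~: A :\ t) 2 <= \sum_(r in ~: A :\ t) degree_in G A r by exact: leq_sum.
  by rewrite total sum_nat_const cardD.
have uniqf x x' t : x \in A -> x' \in A -> t \in ~: A -> G x t -> G x' t -> x = x'.
  move=> xinA x'A tA xt x't; apply/eqP/negPn/negP => nxx.
  have t2 : 2 <= degree_in G A t.
    by apply/card_gt1P; exists x, x'; rewrite !inE !(G_sym t) xt x't !andbT in xinA x'A *.
  move: total; rewrite (big_setD1 t) //=.
  have : \sum_(r in ~: A :\ t) 1 <= \sum_(r in ~: A :\ t) degree_in G A r.
    by apply: leq_sum => r; rewrite finset.in_setD1 => /andP[_ /ge1].
  by rewrite sum1_card cardD //; move: t2; move: (degree_in G A t) (\sum_(r in _) _); clear; lia.
have match_ x : x \in A -> exists t, [set t in ~: A | G x t] = [set t].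
  by move=> /xA h; apply/cards1P; rewrite -/(degree_in G (~: A) x) h.
have fP x : exists t, x \in A -> [set t in ~: A | G x t] = [set t].
  have [/match_[t ht]|_] := boolP (x \in A); first by exists t.
  by exists x.
have [f fE] := choice fP.
have f_out x : x \in A -> f x \in ~: A /\ G x (f x).
  move=> h; have : f x \in [set t in ~: A | G x t] by rewrite fE // finset.set11.
  by rewrite !inE => /andP[? ?]; split; rewrite ?inE.
have nonadj x x' : x \in A -> x' \in A -> x != x' -> ~~ G x (f x').
  move=> xinA x'A; apply: contra => xf; apply/eqP.
  by have [fout adj] := f_out _ x'A; apply: uniqf xf adj.
have nonadj' x x' : x \in A -> x' \in A -> x != x' -> ~~ G (f x') x.
  by rewrite G_sym; exact: nonadj.
have [cA yA aA bA] : [/\ c \in A, y \in A, a \in A & b \in A] by rewrite !inE !eqxx !orbT.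
have [nbc nay] : b != c /\ a != y by split; rewrite eq_sym.
have [nyc nba] : y != c /\ b != a by split; rewrite eq_sym.
(* The chords of this octagon are c (f b) and y (f a). *)
pose w := [:: c; f y; a; f b; y; f c; b; f a].
exists w, [:: (c, f y, a, f b); (y, f c, b, f a); (c, f b, y, f a)]; split.
- apply: perm_enum_uniq; last by rewrite card8.
  have fx x x' : x \in A -> x' \in A -> (f x == x') = false.
    by move=> /f_out[]; rewrite inE => h _ h'; apply/negbTE; apply: contra h => /eqP->.
  have fx' x x' : x \in A -> x' \in A -> (x' == f x) = false.
    by move=> ? ?; rewrite eq_sym fx.
  have ff x x' : x \in A -> x' \in A -> (f x == f x') = (x == x').
    move=> h h'; apply/eqP/eqP => [e|->//]; have [fout adj] := f_out _ h; have [fout' adj'] := f_out _ h'.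
    by apply: uniqf fout _ _ => //; rewrite e.
  rewrite /w /= !inE !ff // !fx // !fx' // !negb_or /=.
  by rewrite nca cy ncb nay ab nyb nyc nya nbc nba.
- apply: (@quadrangulation_ear _ [::]); apply: (@quadrangulation_ear _ [:: c; f b] [::]).
  exact: quadrangulation_quad.
move=> Q; rewrite !inE => /or3P[] /eqP-> u v; rewrite !inE !xpair_eqE => /or4P[] /andP[/eqP-> /eqP->];
  by [apply: nonadj | apply: nonadj'].
Qed.

Lemma avoiding_quadrangulation_eq8 : avoiding_quadrangulation G.
Proof.
have [/existsP[c /existsP[a /existsP[b /and3P[ca cb ab]]]]|/existsPn h] :=
  boolP [exists c, exists a, exists b, [&& G c a, G c b & G a b]].
  exact: triangle_avoiding_quadrangulation ca cb ab.
apply: triangle_free_avoiding_quadrangulation => x y z xy yz.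
have /existsPn/(_ y)/existsPn/(_ z) := h x.
by rewrite xy yz andbT.
Qed.

End EightVertices.

Import Order.TTheory GRing.Theory Num.Theory.
Import numFieldNormedType.Exports.

Local Open Scope classical_set_scope.
Local Open Scope ring_scope.

(** * Orientation of plane triples *)

Section Orientation.
Variable R : realType.
Local Notation plane := 'rV[R]_2.
Implicit Types a b c d z w : plane.

(** Twice the signed area of the triangle a b z, positive when z is to the left of
    the line from a to b. *)
Definition orient a b z : R :=
  (b 0 0 - a 0 0) * (z 0 1 - a 0 1) - (b 0 1 - a 0 1) * (z 0 0 - a 0 0).

Lemma orient_rot a b c : orient a b c = orient b c a.
Proof. by rewrite /orient; ring. Qed.

Lemma orient_swap a b c : orient b a c = - orient a b c.
Proof. by rewrite /orient; ring. Qed.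

Lemma orient_aab a b : orient a a b = 0.
Proof. by rewrite /orient; ring. Qed.

Lemma orient_aba a b : orient a b a = 0.
Proof. by rewrite /orient; ring. Qed.

Lemma orient_abb a b : orient a b b = 0.
Proof. by rewrite /orient; ring. Qed.

Lemma orient_comb a b z w s :
  orient a b ((1 - s) *: z + s *: w) = (1 - s) * orient a b z + s * orient a b w.
Proof. by rewrite /orient !mxE; ring. Qed.

Lemma planeP z w : z 0 0 = w 0 0 -> z 0 1 = w 0 1 -> z = w.
Proof.
move=> h0 h1; apply/rowP => -[[|[|//]] i].
  by rewrite (_ : Ordinal i = 0) //; apply/val_inj.
by rewrite (_ : Ordinal i = 1) //; apply/val_inj.
Qed.

Lemma segment_subset (A : set plane) a b :
  (forall s, 0 <= s <= 1 -> A ((1 - s) *: a + s *: b)) -> segment a b `<=` A.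
Proof. by move=> h _ [s /= s01 <-]; apply: h; move: s01; rewrite in_itv. Qed.

Lemma segmentC a b : segment a b = segment b a.
Proof.
rewrite eqEsubset; split; apply: segment_subset => s s01;
  exists (1 - s); rewrite ?subKr 1?addrC // /= in_itv /=; lra.
Qed.

Lemma segmentl a b : segment a b a.
Proof. by exists 0; rewrite /= ?in_itv /= ?lexx ?ler01 // subr0 scale1r scale0r addr0. Qed.

Lemma segmentr a b : segment a b b.
Proof. by rewrite segmentC; exact: segmentl. Qed.

(** On the line through a and b, being weakly left of the line d a excludes the points
    before a, and being weakly left of b c those beyond b. *)
Lemma on_segment a b c d z : orient a b z = 0 ->
  0 < orient d a b -> 0 < orient b c a -> 0 <= orient d a z -> 0 <= orient b c z ->
  segment a b z.
Proof.
move=> zab dab bca daz bcz.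
pose s := orient d a z / orient d a b.
have zE : z = (1 - s) *: a + s *: b.
  have nz : orient d a b != 0 by rewrite gt_eqF.
  have co x y : x * orient d a b = y * orient d a b -> x = y by move/(mulIf nz).
  have sE : s * orient d a b = orient d a z by rewrite /s divfK.
  apply: planeP; rewrite !mxE; apply: co.
    rewrite mulrDl !mulrBl mul1r mulrAC sE [_ * b 0 0 * _]mulrAC sE.
    have : (a 0 0 - d 0 0) * orient a b z = 0 by rewrite zab mulr0.
    by rewrite /orient; lra.
  rewrite mulrDl !mulrBl mul1r mulrAC sE [_ * b 0 1 * _]mulrAC sE.
  have : (a 0 1 - d 0 1) * orient a b z = 0 by rewrite zab mulr0.
  by rewrite /orient; lra.
exists s => //=; rewrite in_itv /= divr_ge0 ?(ltW dab) //= -subr_ge0.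
by move: bcz; rewrite zE orient_comb orient_aba mulr0 addr0 pmulr_lge0.
Qed.

Lemma segment_orient a b z : segment a b z ->
  exists2 s, 0 <= s <= 1 & z = (1 - s) *: a + s *: b.
Proof. by move=> [s /= s01 <-]; exists s => //; rewrite in_itv in s01. Qed.

(** A segment weakly to the left of a line meets it in an endpoint, or else lies on
    it entirely. *)
Lemma orient_touch a b x y (s : R) : 0 <= s <= 1 -> 0 <= orient a b x -> 0 <= orient a b y ->
  orient a b ((1 - s) *: x + s *: y) = 0 ->
  [\/ (1 - s) *: x + s *: y = x /\ orient a b x = 0,
      (1 - s) *: x + s *: y = y /\ orient a b y = 0 |
      orient a b x = 0 /\ orient a b y = 0].
Proof.
move=> /andP[]; rewrite le_eqVlt => /orP[/eqP <- _ _ _|s0].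
  by rewrite subr0 scale1r scale0r addr0; constructor 1.
rewrite le_eqVlt => /orP[/eqP -> _ _|s1 x0 y0].
  by rewrite subrr scale1r scale0r add0r; constructor 2.
rewrite orient_comb => /eqP; rewrite paddr_eq0; last 2 first.
- by rewrite mulr_ge0 // subr_ge0 ltW.
- by rewrite mulr_ge0 // ltW.
rewrite !mulf_eq0 subr_eq0 (gt_eqF s1) (gt_eqF s0) /= => /andP[/eqP-> /eqP->].
by constructor 3.
Qed.

Lemma orient_continuous a b : continuous (orient a b).
Proof.
have co (i : 'I_2) (k : R) : continuous (fun w : plane => w 0 i - k).
  move=> w; apply: (@continuousB _ _ _ (fun w : plane => w 0 i) (fun=> k)).
    exact: coord_continuous.
  exact: cst_continuous.
move=> z.
apply: (@continuousB _ _ _ (fun w : plane => (b 0 0 - a 0 0) * (w 0 1 - a 0 1))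
  (fun w : plane => (b 0 1 - a 0 1) * (w 0 0 - a 0 0))).
  apply: (@continuousM _ _ (fun=> _) (fun w : plane => w 0 1 - a 0 1)).
    exact: cst_continuous.
  exact: co.
apply: (@continuousM _ _ (fun=> _) (fun w : plane => w 0 0 - a 0 0)).
  exact: cst_continuous.
exact: co.
Qed.

Lemma segment_continuous a b : continuous (fun s : R => (1 - s) *: a + s *: b).
Proof.
move=> s; apply: (@continuousD _ _ _ (fun s : R => (1 - s) *: a) (fun s : R => s *: b)).
  apply: (@continuousZr_tmp _ _ _ (fun s : R => 1 - s)).
  by apply: (@continuousB R R^o R (fun=> 1) id); [exact: cst_continuous | exact: cvg_id].
by apply: (@continuousZr_tmp _ _ _ id); exact: cvg_id.
Qed.

Lemma connected_segment a b : connected (segment a b).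
Proof.
apply: connected_continuous_connected; first exact: segment_connected.
by apply: continuous_subspaceT; exact: segment_continuous.
Qed.

Lemma open_orient_gt0 a b : open [set z | 0 < orient a b z].
Proof.
rewrite (_ : mkset _ = orient a b @^-1` [set x | 0 < x]) //.
by apply: open_comp; [move=> *; exact: orient_continuous | exact: open_gt].
Qed.

Lemma closed_orient_ge0 a b : closed [set z | 0 <= orient a b z].
Proof.
rewrite (_ : mkset _ = orient a b @^-1` [set x | 0 <= x]) //.
by apply: closed_comp; [move=> *; exact: orient_continuous | exact: closed_ge].
Qed.

End Orientation.

(** * Convex quadrilaterals *)

Section Quadrilateral.
Variable R : realType.
Local Notation plane := 'rV[R]_2.
Variables a b c d : plane.
Hypotheses (abc : 0 < orient a b c) (abd : 0 < orient a b d).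
Hypotheses (acd : 0 < orient a c d) (bcd : 0 < orient b c d).

Definition quad_interior : set plane :=
  [set z | 0 < orient a b z] `&` [set z | 0 < orient b c z] `&`
  [set z | 0 < orient c d z] `&` [set z | 0 < orient d a z].

Definition quad_closed : set plane :=
  [set z | 0 <= orient a b z] `&` [set z | 0 <= orient b c z] `&`
  [set z | 0 <= orient c d z] `&` [set z | 0 <= orient d a z].

Definition quad_frame : set plane :=
  segment a b `|` segment b c `|` segment c d `|` segment d a.

Lemma open_quad_interior : open quad_interior.
Proof. by do 3?apply: openI; exact: open_orient_gt0. Qed.

Lemma closed_quad_closed : closed quad_closed.
Proof. by do 3?apply: closedI; exact: closed_orient_ge0. Qed.

Let bca : 0 < orient b c a. Proof. by rewrite -orient_rot. Qed.
Let cda : 0 < orient c d a. Proof. by rewrite -orient_rot. Qed.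
Let cdb : 0 < orient c d b. Proof. by rewrite -orient_rot. Qed.
Let dab : 0 < orient d a b. Proof. by rewrite orient_rot. Qed.
Let dac : 0 < orient d a c. Proof. by rewrite orient_rot. Qed.

(** This serves both to approach any point of the closed quadrilateral from inside
    and to see that the interior is star-shaped. *)
Lemma quad_interior_comb z w s : quad_closed z -> quad_interior w -> 0 < s <= 1 ->
  quad_interior ((1 - s) *: z + s *: w).
Proof.
move=> [[[z1 z2] z3] z4] [[[w1 w2] w3] w4] /andP[s0 s1].
have s1' : 0 <= 1 - s by rewrite subr_ge0.
by do 3?split; rewrite /= orient_comb ltr_wpDl ?mulr_ge0 ?mulr_gt0.
Qed.

Lemma quad_interior_sub : quad_interior `<=` quad_closed.
Proof. by move=> z [[[/= *]]]; do 3?split; rewrite /= ltW. Qed.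

Lemma quad_interior_mid : quad_interior ((1 - 2^-1) *: a + 2^-1 *: c).
Proof.
have h : 1 - 2^-1 = 2^-1 :> R by field.
by do 3?split; rewrite /= orient_comb ?h
   ?(orient_aba, orient_aab, orient_abb) mulr0 ?(addr0, add0r) mulr_gt0 ?invr_gt0.
Qed.

Lemma quad_closedE : quad_closed = quad_interior `|` quad_frame.
Proof.
rewrite eqEsubset; split=> z.
  move=> [[[/= z1 z2] z3] z4].
  move: (z1) (z2) (z3) (z4).
  rewrite le_eqVlt => /orP[/eqP/esym e _ _ _|e1].
    by right; left; left; left; apply: (on_segment e dab bca).
  rewrite le_eqVlt => /orP[/eqP/esym e _ _|e2].
    by right; left; left; right; apply: (on_segment e abc cdb).
  rewrite le_eqVlt => /orP[/eqP/esym e _|e3].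
    by right; left; right; apply: (on_segment e bcd dac).
  rewrite le_eqVlt => /orP[/eqP/esym e|e4].
    by right; right; apply: (on_segment e cda abd).
  by left; do 3?split.
move=> [/quad_interior_sub //|].
move=> [[[|]|]|] /segment_orient[s /andP[s0 s1] ->]; do 3?split; rewrite /= orient_comb
   ?(orient_aba, orient_aab, orient_abb) ?mulr0 ?(addr0, add0r) //.
all: have s1' : 0 <= 1 - s by rewrite subr_ge0.
all: by rewrite ?addr_ge0 ?mulr_ge0 // ltW.
Qed.

Lemma closure_quad_interior : closure quad_interior = quad_closed.
Proof.
rewrite eqEsubset; split.
  rewrite [X in _ `<=` X](iffLR (closure_id _) closed_quad_closed).
  exact: closureS quad_interior_sub.
move=> z zQ.
apply: (@closed_cvg _ _ ((0 : R)^'+) _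
  (fun s : R => (1 - s) *: z + s *: ((1 - 2^-1) *: a + 2^-1 *: c))).
- exact: closed_closure.
- near=> s; apply: subset_closure; apply: quad_interior_comb => //.
    exact: quad_interior_mid.
  by apply/andP; split; near: s; [exact: nbhs_right_gt | apply: nbhs_right_ltW].
- apply: cvg_at_right_filter.
  rewrite [X in _ --> X](_ : z = (1 - 0) *: z + 0 *: ((1 - 2^-1) *: a + 2^-1 *: c)).
    exact: segment_continuous.
  by rewrite subr0 scale1r scale0r addr0.
Unshelve. all: end_near.
Qed.

Lemma connected_quad_interior : connected quad_interior.
Proof.
have m := quad_interior_mid.
rewrite (_ : quad_interior = \bigcup_(z in quad_interior)
  segment z ((1 - 2^-1) *: a + 2^-1 *: c)).
  apply: bigcup_connected.
    by exists ((1 - 2^-1) *: a + 2^-1 *: c) => z _; exact: segmentr.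
  by move=> z _; exact: connected_segment.
rewrite eqEsubset; split=> [z zQ|]; first by exists z => //; exact: segmentl.
apply: bigcup_sub => z zQ; apply: segment_subset => s /andP[].
rewrite le_eqVlt => /orP[/eqP <- _|s0 s1].
  by rewrite subr0 scale1r scale0r addr0.
by apply: quad_interior_comb; [exact: quad_interior_sub | | rewrite s0].
Qed.

Lemma quad_interior_frame z : quad_interior z -> ~ quad_frame z.
Proof.
move=> [[[/= z1 z2] z3] z4].
by move=> [[[|]|]|] /segment_orient[s _ zE];
  move: z1 z2 z3 z4; rewrite {}zE !orient_comb ?(orient_aba, orient_aab, orient_abb) ?mulr0 ?addr0 ?ltxx.
Qed.

Lemma boundary_quad_interior : boundary quad_interior = quad_frame.
Proof.
rewrite /boundary closure_quad_interior quad_closedE.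
rewrite (iffLR (interior_id _) open_quad_interior).
rewrite eqEsubset; split=> z; first by move=> [[]].
by move=> zF; split; [right | move/quad_interior_frame].
Qed.

(** The interior is connected, and it is open and closed relative to any set that
    misses the frame, so it is a whole component. *)
Lemma component_quad_interior (D : set plane) z :
  quad_interior `<=` ~` D -> quad_frame `<=` D -> quad_interior z ->
  connected_component (~` D) z = quad_interior.
Proof.
move=> QD FD zQ.
have zD : (~` D) z by exact: QD.
have sub : quad_interior `<=` connected_component (~` D) z.
  by apply: connected_component_max => //; exact: connected_quad_interior.
have := @component_connected _ (~` D) z.
move=> /(_ quad_interior) <- //.
- by exists z.
- exists quad_interior; first exact: open_quad_interior.
  by rewrite setIC; apply/esym/setIidPl.
- exists quad_closed; first exact: closed_quad_closed.
  rewrite eqEsubset; split=> w; first by move=> wQ; split; [exact: sub | exact: quad_interior_sub].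
  move=> [/connected_component_sub wD]; rewrite quad_closedE => -[//|/FD].
  by move/wD.
Qed.

End Quadrilateral.

(** * Convex hulls *)

Section ConvexSets.
Variable R : realType.
Local Notation plane := 'rV[R]_2.
Implicit Types (a b c d z w : plane) (C : set plane).

Lemma convex_set_comb C z w s : convex_set C -> C z -> C w -> 0 <= s <= 1 ->
  C ((1 - s) *: z + s *: w).
Proof.
move=> Cc Cz Cw /andP[s0 s1].
have := Cc w z (Itv01 s0 s1); rewrite !inE => /(_ Cw Cz).
by rewrite addrC.
Qed.

Lemma convex_orient_ge0 a b : convex_set [set z | 0 <= orient a b z].
Proof.
move=> z w l; rewrite !inE /= => hz hw.
have -> : conv l (z : convex_lmodType plane) w = (1 - l%:num) *: w + l%:num *: z :> plane by rewrite addrC.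
by rewrite orient_comb addr_ge0 ?mulr_ge0 // subr_ge0.
Qed.

Lemma convex_hull_convex (A : set plane) : convex_set (convex_hull A).
Proof.
move=> z w l; rewrite !inE => hz hw C [Cc AC].
by apply/set_mem/Cc; apply/mem_set; [exact: hz | exact: hw].
Qed.

Lemma sub_convex_hull (A : set plane) : A `<=` convex_hull A.
Proof. by move=> z Az C [_]; apply. Qed.

Lemma convex_hull_orient_ge0 (A : set plane) a b :
  (forall z, A z -> 0 <= orient a b z) -> forall z, convex_hull A z -> 0 <= orient a b z.
Proof. by move=> h z /(_ _ (conj (@convex_orient_ge0 a b) h)). Qed.

(** The barycentric coordinates of z are the orientations at the three sides divided
    by their sum, which is orient a b c. *)
Lemma convex_triangle C a b c z : convex_set C -> C a -> C b -> C c ->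
  0 < orient a b c -> 0 <= orient a b z -> 0 <= orient b c z -> 0 <= orient c a z -> C z.
Proof.
move=> Cc Ca Cb Cd D0 c0 a0 b0.
set al := orient b c z in a0; set be := orient c a z in b0; set ga := orient a b z in c0.
have DE : orient a b c = al + be + ga by rewrite /al /be /ga /orient; ring.
have zE (i : 'I_2) : orient a b c * z 0 i = al * a 0 i + be * b 0 i + ga * c 0 i.
  by case: i => -[|[|//]] hi; rewrite /al /be /ga /orient;
    [rewrite (_ : Ordinal hi = 0) | rewrite (_ : Ordinal hi = 1)]; try exact/val_inj; ring.
have [bg0|bg0] := eqVneq (be + ga) 0.
  have [be0 ga0] : be = 0 /\ ga = 0 by lra.
  suff -> : z = a by [].
  have D1 : orient a b c != 0 by rewrite gt_eqF.
  by apply: planeP; apply: (mulfI D1); rewrite zE be0 ga0 DE be0 ga0; ring.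
have bgp : 0 < be + ga by rewrite lt_neqAle eq_sym bg0 addr_ge0.
have D1 : al + be + ga != 0 by rewrite -DE gt_eqF.
(* The line from a through z meets the side from b to c in w. *)
pose w := (1 - ga / (be + ga)) *: b + (ga / (be + ga)) *: c.
have Cw : C w.
  by apply: convex_set_comb => //; rewrite divr_ge0 ?(ltW bgp) //= ler_pdivrMr // mul1r lerDr.
suff -> : z = (1 - (be + ga) / orient a b c) *: a + ((be + ga) / orient a b c) *: w.
  apply: convex_set_comb => //; rewrite divr_ge0 ?(ltW bgp) ?(ltW D0) //=.
  by rewrite ler_pdivrMr // mul1r DE; lra.
by apply: planeP; apply: (mulfI (_ : orient a b c != 0)); rewrite ?zE ?DE // !mxE; field; rewrite D1 bg0.
Qed.

Lemma quad_interior_hull (A : set plane) a b c d : A a -> A b -> A c -> A d ->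
  0 < orient a b c -> 0 < orient a c d ->
  quad_interior a b c d `<=` convex_hull A.
Proof.
move=> Aa Ab Ac Ad abc acd z [[[/= z1 z2] z3] z4].
have [acz|acz] := leP 0 (orient a c z).
  by apply: (@convex_triangle _ a c d) => //; try exact: sub_convex_hull;
    (exact: convex_hull_convex || exact: ltW).
apply: (@convex_triangle _ a b c) => //; try exact: sub_convex_hull;
    try (exact: convex_hull_convex || exact: ltW).
by rewrite orient_swap oppr_ge0 ltW.
Qed.

(** The midpoint of the diagonal has the interior of the quadrilateral as an open
    neighbourhood inside the hull. *)
Lemma diagonal_interior (A : set plane) a b c d : A a -> A b -> A c -> A d ->
  0 < orient a b c -> 0 < orient a b d -> 0 < orient a c d -> 0 < orient b c d ->
  ~ segment a c `<=` boundary (convex_hull A).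
Proof.
move=> Aa Ab Ac Ad abc abd acd bcd /(_ ((1 - 2^-1) *: a + 2^-1 *: c)).
case; first by exists 2^-1 => //=; rewrite in_itv /=; lra.
move=> _; apply.
have : quad_interior a b c d `<=` convex_hull A by exact: quad_interior_hull.
rewrite (open_subsetE _ (@open_quad_interior _ a b c d)); apply.
exact: quad_interior_mid.
Qed.

End ConvexSets.

(** * Drawing a quadrangulation *)

Section DrawnQuadrangulation.
Variables (R : realType) (n : nat) (q : nat -> 'rV[R]_2).
Hypothesis ccw : forall i j k, (i < j)%N -> (j < k)%N -> (k < n)%N ->
  0 < orient (q i) (q j) (q k).

Lemma orient_between i j k : (i < j < n)%N -> (i <= k <= j)%N ->
  orient (q i) (q j) (q k) <= 0.
Proof.
move=> /andP[ij jn] /andP[ik kj].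
have [->|ki] := eqVneq k i; first by rewrite orient_aba.
have [->|jk] := eqVneq k j; first by rewrite orient_abb.
rewrite -orient_rot orient_swap oppr_le0 ltW // ccw //; lia.
Qed.

Lemma orient_outside i j k : (i < j < n)%N -> (k < n)%N -> (k <= i)%N || (j <= k)%N ->
  orient (q j) (q i) (q k) <= 0.
Proof.
move=> /andP[ij jn] kn.
have [->|ki] := eqVneq k i; first by rewrite orient_abb.
have [->|jk] := eqVneq k j; first by rewrite orient_aba.
move=> /orP[h|h]; rewrite orient_swap oppr_le0 ltW //.
  by rewrite orient_rot orient_rot ccw //; lia.
by rewrite ccw //; lia.
Qed.

Lemma orient_neq0 i j k : (i < n)%N -> (j < n)%N -> (k < n)%N -> i != j ->
  orient (q i) (q j) (q k) = 0 -> k = i \/ k = j.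
Proof.
wlog ij : i j / (i < j)%N => [H|] hi hj hk nij.
  case: (ltngtP i j) => [h|h|h]; [by apply: H | | by rewrite h eqxx in nij].
  move=> h0; apply/or_comm; apply: H => //; first by rewrite eq_sym.
  by rewrite orient_swap h0 oppr0.
have [->|ki] := eqVneq k i; first by left.
have [->|jk] := eqVneq k j; first by right.
have [h|h] := ltnP k i.
  by rewrite -orient_rot => /eqP; rewrite gt_eqF // ccw.
have [h'|h'] := ltnP k j.
  by rewrite -orient_rot orient_swap => /eqP; rewrite oppr_eq0 gt_eqF // ccw //; lia.
by move/eqP; rewrite gt_eqF // ccw //; lia.
Qed.

Definition drawn_interior (Q : nat * nat * nat * nat) :=
  let: (a, b, c, d) := Q in quad_interior (q a) (q b) (q c) (q d).

Definition drawn_frame (Q : nat * nat * nat * nat) :=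
  let: (a, b, c, d) := Q in quad_frame (q a) (q b) (q c) (q d).

(** The line through the cut from a to d has the ear on one side and the remaining
    polygon on the other. Conversely, the ear lies entirely behind that side of an
    older quadrilateral whose ends enclose a and d. *)
Lemma noncrossing s Qs : quadrangulation s Qs -> sorted ltn s ->
  {in s, forall x, (x < n)%N} ->
  forall Q Q' k l, Q \in Qs -> Q' \in Qs -> (k, l) \in quad_sides Q' ->
  exists i j, [/\ (i, j) \in quad_sides Q, orient (q i) (q j) (q k) <= 0 &
                  orient (q i) (q j) (q l) <= 0].
Proof.
have self Q k l : (k, l) \in quad_sides Q ->
    exists i j, [/\ (i, j) \in quad_sides Q, orient (q i) (q j) (q k) <= 0 &
                  orient (q i) (q j) (q l) <= 0].
  by move=> h; exists k, l; split; rewrite // ?orient_aba ?orient_abb.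
elim=> [a b c d|s1 s2 a b c d {}Qs quadQs IH] ss sn Q Q' k l.
  by rewrite !inE => /eqP-> /eqP->; exact: self.
have [ss' ab bc cd far] := sorted_ear ss.
have sn' : {in s1 ++ [:: a, d & s2], forall x, (x < n)%N}.
  move=> x; rewrite mem_cat !inE => h; apply: sn; rewrite mem_cat !inE.
  by case/or4P: h => ->; rewrite ?orbT.
have dn : (d < n)%N by apply: sn'; rewrite mem_cat !inE eqxx !orbT.
have ad : (a < d < n)%N by lia.
have sides_sub (P : nat * nat * nat * nat) : (k, l) \in quad_sides P ->
    let: (x, y, z, t) := P in k \in [:: x; y; z; t] /\ l \in [:: x; y; z; t].
  move: P => [[[x y] z] t]; rewrite !inE !xpair_eqE.
  by case/or4P=> /andP[-> ->]; rewrite ?orbT.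
rewrite !inE => /orP[/eqP->|QQs] /orP[/eqP->|Q'Qs]; [exact: self| | |exact: IH].
  move: Q' Q'Qs => [[[x y] z] t] /(quadrangulation_corners quadQs ss')[_ _ _ sub].
  move=> /sides_sub[/sub ks /sub ls].
  exists d, a; rewrite !inE eqxx ?orbT; split => //.
    by apply: (orient_outside ad (sn' _ ks)); apply/orP; exact: far.
  by apply: (orient_outside ad (sn' _ ls)); apply/orP; exact: far.
move=> /sides_sub[kear lear].
have kad : (a <= k <= d)%N by move: kear; rewrite !inE => /or4P[] /eqP->; lia.
have lad : (a <= l <= d)%N by move: lear; rewrite !inE => /or4P[] /eqP->; lia.
move: Q QQs => [[[x y] z] t] /(quadrangulation_corners quadQs ss')[xy yz zt sub].
have inn (i : nat) : i \in [:: x; y; z; t] -> (i < n)%N /\ ((i <= a)%N \/ (d <= i)%N).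
  by move=> /sub h; split; [exact: sn' | exact: far].
have [xn hx] := inn x (mem_head _ _).
have [yn hy] : (y < n)%N /\ ((y <= a)%N \/ (d <= y)%N) by apply: inn; rewrite !inE eqxx ?orbT.
have [zn hz] : (z < n)%N /\ ((z <= a)%N \/ (d <= z)%N) by apply: inn; rewrite !inE eqxx ?orbT.
have [tn ht] : (t < n)%N /\ ((t <= a)%N \/ (d <= t)%N) by apply: inn; rewrite !inE eqxx ?orbT.
have kn : (k < n)%N by lia.
have ln : (l < n)%N by lia.
clear far sn sn' ss ss' sub IH self sides_sub inn.
have [h|[h|[h|h]]] : ((x <= a) && (d <= y) \/ (y <= a) && (d <= z) \/
   (z <= a) && (d <= t) \/ ((d <= x) || (t <= a)))%N by lia.
- exists x, y; rewrite !inE eqxx ?orbT; split=> //; apply: orient_between; lia.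
- exists y, z; rewrite !inE eqxx ?orbT; split=> //; apply: orient_between; lia.
- exists z, t; rewrite !inE eqxx ?orbT; split=> //; apply: orient_between; lia.
- exists t, x; rewrite !inE eqxx ?orbT; split=> //; apply: orient_outside; lia.
Qed.

(** A point inside the polygon is to the left of the cut from a to d, hence inside the
    remaining polygon, or to its right, hence in the ear, or on the cut. *)
Lemma covering s Qs z : quadrangulation s Qs -> sorted ltn s ->
  {in s, forall x, (x < n)%N} ->
  cycle (fun i j => 0 < orient (q i) (q j) z) s ->
  exists2 Q, Q \in Qs & drawn_interior Q z \/ drawn_frame Q z.
Proof.
elim=> [a b c d _ _|s1 s2 a b c d {}Qs _ IH ss sn].
  move=> /and5P[z1 z2 z3 z4 _]; exists (a, b, c, d); first exact: mem_head.
  by left; do 3?split.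
have [ss' ab bc cd _] := sorted_ear ss.
have dn : (d < n)%N by apply: sn; rewrite mem_cat !inE eqxx !orbT.
have sn' : {in s1 ++ [:: a, d & s2], forall x, (x < n)%N}.
  move=> x; rewrite mem_cat !inE => h; apply: sn; rewrite mem_cat !inE.
  by case/or4P: h => ->; rewrite ?orbT.
rewrite cycle_catC /= => /and4P[z1 z2 z3 h].
have [z0|z0|z0] := ltrgt0P (orient (q a) (q d) z).
- have [|Q Qin hQ] := IH ss' sn'; first by rewrite cycle_catC /= z0.
  by exists Q; rewrite // inE Qin orbT.
- exists (a, b, c, d); first exact: mem_head.
  by left; do 3?split; rewrite //= orient_swap oppr_gt0.
- exists (a, b, c, d); first exact: mem_head.
  right; right; apply: (@on_segment _ _ _ (q b) (q c)); try exact: ltW.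
  + by rewrite orient_swap z0 oppr0.
  + by rewrite -orient_rot ccw //; lia.
  + by rewrite ccw //; lia.
Qed.

End DrawnQuadrangulation.

Definition cyclic_succ n k := if (k.+1 < n)%N then k.+1 else 0%N.

Lemma cycle_iotaP n (e : rel nat) : (0 < n)%N ->
  (forall k, (k < n)%N -> e k (cyclic_succ n k)) <-> cycle e (iota 0 n).
Proof.
case: n => // m _; rewrite [iota _ _]/= [cycle _ _]/= rcons_path.
have lm : last 0%N (iota 1 m) = m.
  by rewrite (last_nth 0%N) size_iota -[_ :: _]/(iota 0 m.+1) nth_iota.
have nthE i : (i <= m)%N -> nth 0%N (0%N :: iota 1 m) i = i.
  by move=> im; rewrite -[_ :: _]/(iota 0 m.+1) nth_iota.
rewrite lm; split=> [h|/andP[/(pathP 0%N) h em] k].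
  apply/andP; split; last by have := h m (leqnn _); rewrite /cyclic_succ ltnn.
  apply/(pathP 0%N) => i; rewrite size_iota => im.
  by rewrite (nthE _ (ltnW im)) nth_iota //; have := h i (ltnW im); rewrite /cyclic_succ ltnS im.
rewrite ltnS leq_eqVlt /cyclic_succ ltnS => /orP[/eqP->|km]; first by rewrite ltnn.
rewrite km; have := h k; rewrite size_iota.
by rewrite (nthE _ (ltnW km)) nth_iota //; apply.
Qed.

Section FourAngulation.
Variables (R : realType) (n : nat) (p : 'I_n -> 'rV[R]_2).
Variables (sigma : nat -> 'I_n) (tau : 'I_n -> nat) (Qs : seq (nat * nat * nat * nat)).
Hypotheses (tau_lt : forall i, (tau i < n)%N) (tauK : cancel tau sigma).
Hypothesis sigmaK : forall k, (k < n)%N -> tau (sigma k) = k.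
Local Notation q := (p \o sigma).
Hypothesis ccw : forall i j k, (i < j)%N -> (j < k)%N -> (k < n)%N ->
  0 < orient (q i) (q j) (q k).
Hypotheses (n_ge4 : (4 <= n)%N) (quadQs : quadrangulation (iota 0 n) Qs).
Local Notation H := (fun i j => side_rel Qs (tau i) (tau j)).
Local Notation succ := (cyclic_succ n).

Let ptau i : p i = q (tau i). Proof. by rewrite /= tauK. Qed.

Let corners a b c d : (a, b, c, d) \in Qs -> [/\ (a < b)%N, (b < c)%N, (c < d)%N & (d < n)%N].
Proof.
move=> /(quadrangulation_corners quadQs (iota_ltn_sorted _ _))[-> -> -> sub]; split=> //.
by have := sub d; rewrite !inE eqxx !orbT mem_iota add0n => /(_ isT).
Qed.

Let iota_lt : {in iota 0 n, forall x, (x < n)%N}.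
Proof. by move=> x; rewrite mem_iota. Qed.

Lemma side_distinct Q k l : Q \in Qs -> (k, l) \in quad_sides Q ->
  [/\ k != l, (k < n)%N & (l < n)%N].
Proof.
move: Q => [[[a b] c] d] /corners[ab bc cd dn].
by rewrite !inE !xpair_eqE => /or4P[] /andP[/eqP-> /eqP->]; split; lia.
Qed.

Lemma side_inside Q i j k l : Q \in Qs -> (i, j) \in quad_sides Q ->
  (k, l) \in quad_sides Q -> 0 <= orient (q i) (q j) (q k) /\ 0 <= orient (q i) (q j) (q l).
Proof.
move: Q => [[[a b] c] d] /corners[ab bc cd dn] ij.
suff h x : x \in [:: a; b; c; d] -> 0 <= orient (q i) (q j) (q x).
  rewrite !inE !xpair_eqE => /or4P[] /andP[/eqP-> /eqP->]; split; apply: h;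
    by rewrite !inE eqxx ?orbT.
rewrite -oppr_le0 -orient_swap => xQ.
have hx : [|| x == a, x == b, x == c | x == d] by move: xQ; rewrite !inE.
move: ij; rewrite !inE !xpair_eqE => /or4P[] /andP[/eqP-> /eqP->].
- by apply: (orient_outside ccw); lia.
- by apply: (orient_outside ccw); lia.
- by apply: (orient_outside ccw); lia.
- by apply: (orient_between ccw); lia.
Qed.

(** The separating line passes through a side of a quadrilateral that has k l as a
    side, and is found by applying noncrossing to one that has i j. *)
Lemma sides_separated i j k l : side_rel Qs i j -> side_rel Qs k l ->
  exists a b, [/\ a != b, (a < n)%N && (b < n)%N,
    orient (q a) (q b) (q i) <= 0 /\ orient (q a) (q b) (q j) <= 0 &
    0 <= orient (q a) (q b) (q k) /\ 0 <= orient (q a) (q b) (q l)].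
Proof.
move=> /hasP[Q' Q'Qs ij] /hasP[Q QQs kl].
have nc := noncrossing ccw quadQs (iota_ltn_sorted 0 n) iota_lt QQs Q'Qs.
have [a [b [ab abi abj]]] : exists a b, [/\ (a, b) \in quad_sides Q,
    orient (q a) (q b) (q i) <= 0 & orient (q a) (q b) (q j) <= 0].
  by case/orP: ij => /nc[a [b [? ? ?]]]; exists a, b.
have [nab an bn] := side_distinct QQs ab.
exists a, b; rewrite an bn; split => //.
by case/orP: kl => /(side_inside QQs ab)[].
Qed.

Lemma drawn_inj k l : (k < n)%N -> (l < n)%N -> q k = q l -> k = l.
Proof.
move=> kn ln qkl; apply/eqP/negPn/negP => nkl.
have h c : (c < n)%N -> c = k \/ c = l.
  by move=> cn; apply: (orient_neq0 ccw kn ln cn nkl); rewrite qkl orient_aab.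
have [] : [/\ 0 < n, 1 < n & 2 < n]%N by split; lia.
by move=> /h h0 /h h1 /h h2; lia.
Qed.

Lemma segment_touch a b i j z : (a < n)%N -> (b < n)%N -> a != b -> i != j ->
  0 <= orient (q a) (q b) (p i) -> 0 <= orient (q a) (q b) (p j) ->
  orient (q a) (q b) z = 0 -> segment (p i) (p j) z ->
  (exists m, [/\ m = i \/ m = j, z = p m & m = sigma a \/ m = sigma b]) \/
  [set i; j] = [set sigma a; sigma b].
Proof.
move=> an bn nab nij ai aj z0 /segment_orient[s s01 zE].
have on_line m : orient (q a) (q b) (p m) = 0 -> m = sigma a \/ m = sigma b.
  rewrite ptau => /(orient_neq0 ccw an bn (tau_lt m) nab).
  by case=> <-; rewrite tauK; [left|right].
move: z0; rewrite zE => /(orient_touch s01 ai aj)[[-> /on_line h]|[-> /on_line h]|[/on_line hi /on_line hj]].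
- by left; exists i; split => //; left.
- by left; exists j; split => //; right.
- right; case: hi hj nij => -> [] -> //; rewrite ?eqxx // => _.
  by rewrite setUC.
Qed.

(** A common point of two edges is on the separating line. Each edge touches that
    line at a vertex or lies along it, and the line carries no vertices but the
    two that span it. *)
Lemma side_rel_plane : plane_graph p H.
Proof.
move=> i j k l /= Hij Hkl dist z [zij zkl].
have [a [b [nab /andP[an bn] [ai aj] [ak al]]]] := sides_separated Hij Hkl.
rewrite -!ptau in ai aj ak al.
have neq x y : H x y -> x != y.
  move=> /hasP[Q QQs xy]; have [] : tau x != tau y.
    by case/orP: xy => /(side_distinct QQs)[]; rewrite // eq_sym.
  by apply: contra => /eqP->.
have z_le0 : orient (q a) (q b) z <= 0.
  have [s /andP[s0 s1] ->] := segment_orient zij.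
  rewrite orient_comb -oppr_ge0 opprD -!mulrN.
  by rewrite addr_ge0 // mulr_ge0 // ?oppr_ge0 // subr_ge0.
have z_ge0 : 0 <= orient (q a) (q b) z.
  have [s /andP[s0 s1] ->] := segment_orient zkl.
  by rewrite orient_comb addr_ge0 // mulr_ge0 // subr_ge0.
have z0 : orient (q a) (q b) z = 0 by apply/eqP; rewrite eq_le z_le0.
have zb0 : orient (q b) (q a) z = 0 by rewrite orient_swap z0 oppr0.
have bi : 0 <= orient (q b) (q a) (p i) by rewrite orient_swap oppr_ge0.
have bj : 0 <= orient (q b) (q a) (p j) by rewrite orient_swap oppr_ge0.
have nba : b != a by rewrite eq_sym.
have := segment_touch an bn nab (neq _ _ Hkl) ak al z0 zkl.
have := segment_touch bn an nba (neq _ _ Hij) bi bj zb0 zij.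
rewrite [[set sigma b; _]]setUC.
case=> [[m [mij zm mab]]|Eij] [[m' [mkl zm' mab']]|Ekl].
- suff mm : m = m' by exists m => //; split; [exact: mij | rewrite mm; exact: mkl].
  rewrite -(tauK m) -(tauK m'); congr sigma.
  by apply: drawn_inj => //; rewrite -!ptau -zm.
- exists m => //; split; [exact: mij | rewrite Ekl].
  by case: mab => ->; [right|left].
- by exists m' => //; split; [rewrite Eij | exact: mkl].
- by case: dist; rewrite Eij.
Qed.

Lemma cyclic_succ_lt k : (succ k < n)%N.
Proof. by rewrite /cyclic_succ; case: ifP => //; lia. Qed.

Lemma consecutive_ccw k : (k < n)%N -> 0 < orient (q k) (q (succ k)) (q (succ (succ k))).
Proof.
move=> kn; rewrite /cyclic_succ; case: ifP => h1; case: ifP => h2.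
- by apply: ccw.
- by rewrite orient_rot orient_rot ccw //; lia.
- by rewrite orient_rot ccw //; lia.
- lia.
Qed.

Lemma hull_side_ge0 k z : (k < n)%N -> convex_hull (range p) z ->
  0 <= orient (q k) (q (succ k)) z.
Proof.
move=> kn; apply: convex_hull_orient_ge0 => _ [i _ <-].
rewrite -oppr_le0 -orient_swap ptau; have ti := tau_lt i.
rewrite {1}/cyclic_succ; case: ifP => h.
  by apply: (orient_outside ccw); lia.
by apply: (orient_between ccw); lia.
Qed.

Lemma hull_side_segment k z : (k < n)%N -> convex_hull (range p) z ->
  orient (q k) (q (succ k)) z = 0 -> segment (q k) (q (succ k)) z.
Proof.
move=> kn zh z0.
pose d := if k is k'.+1 then k' else n.-1.
have [dn dk] : (d < n)%N /\ succ d = k.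
  by rewrite /d /cyclic_succ; case: k kn {d z0} => [|k]; case: ifP; lia.
apply: (@on_segment _ _ _ (q (succ (succ k))) (q d)) => //.
- by have := consecutive_ccw dn; rewrite dk.
- by rewrite -orient_rot consecutive_ccw.
- by have := hull_side_ge0 dn zh; rewrite dk.
- by apply: hull_side_ge0 => //; exact: cyclic_succ_lt.
Qed.

Lemma succ_side_rel k : (k < n)%N -> side_rel Qs k (succ k).
Proof.
have /cycle_iotaP h := cycle_side_rel quadQs.
by apply: h; lia.
Qed.

(** When k and l are not consecutive, there are vertices on both sides of the
    segment, which is then a diagonal of a convex quadrilateral. *)
Lemma hull_edge_side_rel i j : hull_edge p i j -> H i j.
Proof.
move=> [nij]; rewrite /edge_segment !ptau.
have : tau i != tau j by apply: contra nij => /eqP/(can_inj tauK)->.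
move: (tau i) (tau j) (tau_lt i) (tau_lt j) => k l.
wlog kl : k l / (k < l)%N => [W kn ln nkl|].
  case: (ltngtP k l) => [h|h|h]; [exact: W| |by rewrite h eqxx in nkl].
  by rewrite segmentC side_rel_sym; apply: W => //; rewrite eq_sym.
move=> kn ln _ sub.
have in_range m : range p (q m) by exists (sigma m).
have [kl1|kl1] := eqVneq l k.+1.
  by have := succ_side_rel kn; rewrite /cyclic_succ -kl1 ln.
have [/andP[/eqP k0 /eqP l1]|kl0] := boolP ((k == 0) && (l == n.-1))%N.
  by rewrite side_rel_sym; have := succ_side_rel ln; rewrite /cyclic_succ ifF ?k0 //; lia.
(* Vertex k + 1 is on one side of the segment, and n - 1 or 0 on the other. *)
case: (posnP k) => [k0|k0].
  by case: (@diagonal_interior _ (range p) (q k) (q k.+1) (q l) (q n.-1));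
    rewrite // ?ccw //; lia.
rewrite segmentC in sub.
have gt i' j' k' : (i' < j')%N -> (j' < k')%N -> (k' < n)%N -> 0 < orient (q j') (q k') (q i').
  by move=> *; rewrite -orient_rot ccw.
have gt' i' j' k' : (i' < j')%N -> (j' < k')%N -> (k' < n)%N -> 0 < orient (q k') (q i') (q j').
  by move=> *; rewrite orient_rot ccw.
case: (@diagonal_interior _ (range p) (q l) (q 0%N) (q k) (q k.+1)) => //.
- by apply: gt' => //; lia.
- by apply: gt' => //; lia.
- by apply: gt' => //; lia.
- by apply: ccw => //; lia.
Qed.

Lemma drawing_edge i j : H i j -> segment (p i) (p j) `<=` drawing p H.
Proof. by move=> Hij z zs; right; exists (i, j). Qed.

Lemma frame_drawing Q : Q \in Qs -> drawn_frame q Q `<=` drawing p H.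
Proof.
move=> QQs.
have h k l : (k, l) \in quad_sides Q -> segment (q k) (q l) `<=` drawing p H.
  move=> kl; have [_ kn ln] := side_distinct QQs kl.
  apply: drawing_edge; rewrite !sigmaK //.
  by apply/hasP; exists Q; rewrite // kl.
move: Q QQs h => [[[a b] c] d] _ h z.
by case=> [[[|]|]|]; apply: h; rewrite !inE eqxx ?orbT.
Qed.

Lemma interior_drawing Q : Q \in Qs -> drawn_interior q Q `<=` ~` drawing p H.
Proof.
move=> QQs z zQ.
have noseg k l : side_rel Qs k l -> segment (q k) (q l) z -> False.
  move=> /hasP[Q' Q'Qs kl] /segment_orient[s /andP[s0 s1] zE].
  have nc := noncrossing ccw quadQs (iota_ltn_sorted 0 n) iota_lt QQs Q'Qs.
  have [a [b [ab abk abl]]] : exists a b, [/\ (a, b) \in quad_sides Q,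
      orient (q a) (q b) (q k) <= 0 & orient (q a) (q b) (q l) <= 0].
    by case/orP: kl => /nc[a [b [? ? ?]]]; exists a, b.
  have z_gt0 : 0 < orient (q a) (q b) z.
    move: Q zQ ab {QQs nc} => [[[x y] t] u] [[[? ?] ?] ?].
    by rewrite !inE !xpair_eqE => /or4P[] /andP[/eqP-> /eqP->].
  move: z_gt0; rewrite zE orient_comb ltNge -oppr_ge0 opprD -!mulrN.
  by rewrite addr_ge0 // mulr_ge0 // ?oppr_ge0 // subr_ge0.
case=> [[i _ iz]|[[i j] /= Hij]]; last first.
  by rewrite /edge_segment !ptau; exact: noseg.
apply: (noseg _ _ (succ_side_rel (tau_lt i))); rewrite -ptau -iz; exact: segmentl.
Qed.

(** A point of a face inside the hull is off the sides of the polygon, hence strictly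
    inside it, and so in the interior of a quadrilateral; by
    component_quad_interior that interior is the whole face. *)
Lemma side_rel_four_angulation : four_angulation p H.
Proof.
split.
- split=> [i j|i]; first exact: side_rel_sym.
  apply/negbTE/hasPn => Q QQs; rewrite orbb; apply/negP => /(side_distinct QQs)[].
  by rewrite eqxx.
- exact: side_rel_plane.
- exact: hull_edge_side_rel.
move=> _ [z zD <-] Fh.
have zh : convex_hull (range p) z by apply: Fh; exact: connected_component_refl.
have zpos : cycle (fun i j => 0 < orient (q i) (q j) z) (iota 0 n).
  apply/cycle_iotaP => [|k kn]; first by lia.
  rewrite lt_neqAle hull_side_ge0 // andbT eq_sym; apply/eqP => /(hull_side_segment kn zh) zs.
  apply: zD; move: zs; apply: drawing_edge.
  by rewrite !sigmaK ?cyclic_succ_lt // succ_side_rel.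
have [Q QQs [zQ|/(frame_drawing QQs)//]] :=
  covering ccw quadQs (iota_ltn_sorted 0 n) iota_lt zpos.
have iD := interior_drawing QQs; have fD := frame_drawing QQs.
move: Q QQs zQ iD fD => [[[a b] c] d] QQs zQ iD fD.
have [ab bc cd dn] := corners QQs.
have abc : 0 < orient (q a) (q b) (q c) by apply: ccw; lia.
have abd : 0 < orient (q a) (q b) (q d) by apply: ccw; lia.
have acd : 0 < orient (q a) (q c) (q d) by apply: ccw; lia.
have bcd : 0 < orient (q b) (q c) (q d) by apply: ccw; lia.
rewrite (component_quad_interior abc abd acd bcd iD fD zQ).
have inj k l : (k < n)%N -> (l < n)%N -> (sigma k == sigma l) = (k == l).
  by move=> kn ln; apply/eqP/eqP => [/(congr1 tau)|->]; rewrite ?sigmaK.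
have Hs k l : (k, l) \in quad_sides (a, b, c, d) -> side_rel Qs k l.
  by move=> h; apply/hasP; exists (a, b, c, d); rewrite // h.
exists [:: sigma a; sigma b; sigma c; sigma d]; split => //.
  rewrite /ucycle /= !inE !inj ?sigmaK ?Hs ?inE ?eqxx ?orbT //=; lia.
rewrite boundary_quad_interior // /edge_segment.
rewrite (_ : [set` _] = [set sigma a; sigma b; sigma c; sigma d]); last first.
  by apply/seteqP; split=> x /=; rewrite !inE; [case/or4P => /eqP->; tauto |
    move=> [[[->|->]|->]|->]; rewrite eqxx ?orbT].
rewrite !bigcup_setU !bigcup_set1 /= !inj //; try lia.
rewrite !eqxx /quad_frame.
do ![rewrite ifN //; last lia].
Qed.

End FourAngulation.

(** * Points in convex position *)

Section ConvexPosition.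
Variables (R : realType) (n : nat) (p : 'I_n -> 'rV[R]_2).
Hypothesis hp : convex_position p.

Lemma not_in_triangle i j k l : l != i -> l != j -> l != k ->
  0 < orient (p i) (p j) (p k) ->
  0 <= orient (p i) (p j) (p l) -> 0 <= orient (p j) (p k) (p l) ->
  0 <= orient (p k) (p i) (p l) -> False.
Proof.
move=> li lj lk h *; apply: (hp (i := l)).
have sub m : l != m -> convex_hull (p @` [set j | j != l]) (p m).
  by move=> lm; apply: sub_convex_hull; exists m; rewrite //= eq_sym.
by apply: (convex_triangle _ (sub _ li) (sub _ lj) (sub _ lk)) => //; exact: convex_hull_convex.
Qed.

Lemma not_in_segment i j l s : l != i -> l != j -> 0 <= s <= 1 ->
  p l <> (1 - s) *: p i + s *: p j.
Proof.
move=> li lj s01 pl; apply: (hp (i := l)).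
have sub m : l != m -> convex_hull (p @` [set j | j != l]) (p m).
  by move=> lm; apply: sub_convex_hull; exists m; rewrite //= eq_sym.
rewrite [X in convex_hull _ X]pl.
by apply: convex_set_comb (sub _ li) (sub _ lj) s01; exact: convex_hull_convex.
Qed.

Lemma convex_position_inj : injective p.
Proof.
move=> i l pil; apply/eqP/negPn/negP => nil.
have := @not_in_segment i i l 0; rewrite eq_sym nil => /(_ isT isT).
by rewrite lexx ler01 subr0 scale1r scale0r addr0 => /(_ isT); rewrite pil.
Qed.

Let lex_lt (z w : 'rV[R]_2) := z 0 0 < w 0 0 \/ z 0 0 = w 0 0 /\ z 0 1 < w 0 1.

Lemma lex_min_point : (0 < n)%N -> exists i0, forall i, i != i0 -> lex_lt (p i0) (p i).
Proof.
move=> n0; pose f i : R *l R := (p i 0 0, p i 0 1).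
have [i0 _ hmin] := @Order.TotalTheory.arg_minP _ _ _ (Ordinal n0) xpredT f isT.
exists i0 => i ni.
have := hmin i isT; rewrite leEprodlexi /= => /andP[].
rewrite le_eqVlt => /orP[/eqP e|]; last by left.
rewrite e lexx implyTb le_eqVlt => /orP[/eqP e1|]; last by right.
by case/eqP: ni; apply/esym/convex_position_inj/planeP.
Qed.

(** The points are all seen from a within a half-plane, in which the order by angle
    is linear. *)
Lemma orient_trans a z w v : lex_lt a z -> lex_lt a w -> lex_lt a v ->
  0 <= orient a z w -> 0 <= orient a w v -> 0 <= orient a z v.
Proof.
rewrite /lex_lt /orient.
move: (z 0 0) (z 0 1) (w 0 0) (w 0 1) (v 0 0) (v 0 1) (a 0 0) (a 0 1).
move=> z0 z1 w0 w1 v0 v1 a0 a1.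
have sg (x y : R) : x < y \/ x = y -> 0 <= y - x by rewrite subr_ge0 le_eqVlt => -[->|->]; rewrite ?eqxx ?orbT.
move=> hz [hw|[ew hw]] hv zw wv.
  rewrite -(pmulr_rge0 _ (_ : 0 < w0 - a0)) ?subr_gt0 //.
  rewrite (_ : _ * (_ - _ * (v0 - a0)) = (z0 - a0) * ((w0 - a0) * (v1 - a1) - (w1 - a1) * (v0 - a0)) +
     (v0 - a0) * ((z0 - a0) * (w1 - a1) - (z1 - a1) * (w0 - a0))); last by ring.
  by rewrite addr_ge0 // mulr_ge0 //; apply: sg; [case: hz => [|[]]; tauto|case: hv => [|[]]; tauto].
have v0a : v0 = a0.
  case: hv => [hv|[-> //]]; move: wv; rewrite -ew subrr mul0r sub0r oppr_ge0.
  by rewrite leNgt mulr_gt0 // subr_gt0.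
have v1a : a1 < v1 by case: hv; rewrite v0a ?ltxx // => -[].
rewrite v0a subrr mulr0 subr0 mulr_ge0 ?subr_ge0 ?(ltW v1a) //.
by case: hz => [/ltW|[->]].
Qed.

(** If the least point and two others were collinear, the nearer of the two would
    lie on the segment from the least point to the other. *)
Lemma orient_lex_min_neq0 i0 i j : (forall i, i != i0 -> lex_lt (p i0) (p i)) ->
  i != i0 -> j != i0 -> i != j -> orient (p i0) (p i) (p j) != 0.
Proof.
move=> low ni nj nij; apply/eqP => o0.
have between k l : k != i0 -> l != i0 -> k != l -> forall s, 0 <= s <= 1 ->
    p k = (1 - s) *: p i0 + s *: p l -> False.
  by move=> nk nl nkl s s01; apply: not_in_segment.
have ratio (x y : R) : 0 < x -> x <= y -> 0 <= x / y <= 1.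
  by move=> x0 xy; have y0 := lt_le_trans x0 xy; rewrite ltW ?divr_gt0 //= ler_pdivrMr // mul1r.
have by_x k l : k != i0 -> l != i0 -> k != l -> orient (p i0) (p k) (p l) = 0 ->
    p i0 0 0 < p k 0 0 -> p k 0 0 <= p l 0 0 -> False.
  move=> nk nl nkl o k0 kl.
  have l0 : p l 0 0 - p i0 0 0 != 0 by rewrite gt_eqF // subr_gt0 (lt_le_trans k0).
  apply: (between k l nk nl nkl ((p k 0 0 - p i0 0 0) / (p l 0 0 - p i0 0 0))).
    by apply: ratio; rewrite ?subr_gt0 ?lerD2r.
  apply: planeP; rewrite !mxE; first by field.
  apply: (mulIf l0); rewrite [RHS](_ : _ = (p l 0 0 - p i0 0 0) * p i0 0 1 +
    (p k 0 0 - p i0 0 0) * (p l 0 1 - p i0 0 1)); last by field.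
  by move: o; rewrite /orient; lra.
have by_y k l : k != i0 -> l != i0 -> k != l ->
    p k 0 0 = p i0 0 0 -> p l 0 0 = p i0 0 0 -> p i0 0 1 < p k 0 1 -> p k 0 1 <= p l 0 1 -> False.
  move=> nk nl nkl ek el k0 kl.
  have l0 : p l 0 1 - p i0 0 1 != 0 by rewrite gt_eqF // subr_gt0 (lt_le_trans k0).
  apply: (between k l nk nl nkl ((p k 0 1 - p i0 0 1) / (p l 0 1 - p i0 0 1))).
    by apply: ratio; rewrite ?subr_gt0 ?lerD2r.
  by apply: planeP; rewrite !mxE ?ek ?el; [ring | field].
have case_x k l : k != i0 -> l != i0 -> k != l -> orient (p i0) (p k) (p l) = 0 ->
    p k 0 0 <= p l 0 0 -> False.
  move=> nk nl nkl o kl; case: (low _ nk) => [hk|[ek hk]]; first exact: (by_x k l).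
  case: (low _ nl) => [hl|[el hl]].
    move: o; rewrite /orient -ek subrr mul0r sub0r => /eqP.
    by rewrite oppr_eq0 mulf_eq0 !subr_eq0 !gt_eqF.
  have [h|h] := leP (p k 0 1) (p l 0 1); first exact: (by_y k l).
  by apply: (by_y l k) => //; [rewrite eq_sym | exact: ltW].
have [h|h] := leP (p i 0 0) (p j 0 0); first exact: (case_x i j).
apply: (case_x j i) => //; [by rewrite eq_sym | | exact: ltW].
by rewrite -orient_rot orient_swap o0 oppr0.
Qed.

(** Sort the points by angle around the lexicographically least one. A triple without
    that point turns left as well, since otherwise its middle point would lie in
    the triangle spanned by the least point and the two others. *)
Lemma ccw_labelling : (0 < n)%N -> exists (sigma : nat -> 'I_n) (tau : 'I_n -> nat),
  [/\ forall i, (tau i < n)%N, cancel tau sigma, forall k, (k < n)%N -> tau (sigma k) = k &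
   forall i j k, (i < j)%N -> (j < k)%N -> (k < n)%N ->
     0 < orient (p (sigma i)) (p (sigma j)) (p (sigma k))].
Proof.
move=> n0; have [i0 low] := lex_min_point n0.
pose ang : rel 'I_n := fun i j => 0 <= orient (p i0) (p i) (p j).
pose t := sort ang [seq i <- enum 'I_n | i != i0].
have tP i : i \in t -> i != i0 by rewrite mem_sort mem_filter => /andP[].
have ut : uniq t by rewrite sort_uniq filter_uniq // enum_uniq.
have st : pairwise ang t.
  rewrite -(@sorted_pairwise_in _ [pred i | i != i0]).
  - apply: sort_sorted => i j; rewrite /ang -[orient _ (p j) _]orient_rot orient_swap oppr_ge0.
    by rewrite orient_rot le_total.
  - move=> j i k; rewrite !inE => /low hj /low hi /low hk; exact: orient_trans.
  - by apply/allP => i /tP.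
have s_strict i j : (i < j < size t)%N -> 0 < orient (p i0) (p (nth i0 t i)) (p (nth i0 t j)).
  move=> /andP[ij jt]; have it := ltn_trans ij jt.
  rewrite lt_neqAle eq_sym orient_lex_min_neq0 ?tP ?mem_nth ?nth_uniq ?ltn_eqF //=.
  exact: (pairwiseP i0 st).
have sz : size (i0 :: t) = n.
  rewrite -[RHS](card_ord n) cardE; apply/perm_size/uniq_perm.
  - by rewrite /= ut andbT; apply/negP => /tP; rewrite eqxx.
  - exact: enum_uniq.
  - by move=> i; rewrite !inE mem_sort mem_filter mem_enum inE andbT; case: eqP.
have us : uniq (i0 :: t) by rewrite /= ut andbT; apply/negP => /tP; rewrite eqxx.
have sall i : i \in i0 :: t by rewrite !inE mem_sort mem_filter mem_enum inE andbT; case: eqP.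
exists (nth i0 (i0 :: t)), (index^~ (i0 :: t)); split=> [i|i|k kn|i j k ij jk kn].
- by rewrite -[X in (_ < X)%N]sz index_mem.
- exact: nth_index.
- by rewrite index_uniq // sz.
have szt : (size t).+1 = n := sz.
rewrite -szt in kn; case: j k i ij jk kn => // j [//|k] [|i]; rewrite !ltnS /= => ij jk kt.
  by apply: s_strict; rewrite jk.
have jt := ltn_trans jk kt; have it := ltn_trans ij jt; have ik := ltn_trans ij jk.
rewrite ltNge; apply/negP => h.
apply: (@not_in_triangle i0 (nth i0 t i) (nth i0 t k) (nth i0 t j)).
- by rewrite tP // mem_nth.
- by rewrite nth_uniq // gtn_eqF.
- by rewrite nth_uniq // ltn_eqF.
- by apply: s_strict; rewrite ik.
- by apply: ltW; apply: s_strict; rewrite ij.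
- by rewrite -orient_rot orient_swap oppr_ge0.
- by rewrite orient_rot; apply: ltW; apply: s_strict; rewrite jk.
Qed.

End ConvexPosition.

(** * Placing a cubic graph *)

Lemma cubic_avoiding_quadrangulation (V : finType) (G : rel V) m :
  simple_graph G -> regular_graph 3 G -> (4 <= m)%N -> #|V| = m.*2 ->
  avoiding_quadrangulation G.
Proof.
move=> [G_sym G_irr] cubic m4 cardV.
have [m_eq4|m_neq4] := eqVneq m 4%N.
  by apply: avoiding_quadrangulation_eq8 => //; rewrite cardV m_eq4.
by apply: (avoiding_quadrangulation_ge10 G_sym G_irr cubic cardV); lia.
Qed.

Lemma map_index_iota (T : eqType) (s : seq T) : uniq s -> map (index^~ s) s = iota 0 (size s).
Proof.
case: s => // x s us; apply: (@eq_from_nth _ 0%N); first by rewrite size_map size_iota.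
by move=> i; rewrite size_map => i_s; rewrite (nth_map x) // index_uniq // nth_iota.
Qed.

Theorem theorem7 (R : realType) (t n : nat) (ht : (2 <= t)%N)
    (hn : n = (4 + 2 * t)%N)
    (p : 'I_n -> 'rV[R]_2) (hp : convex_position p)
    (V : finType) (G : rel V) (hG : simple_graph G)
    (hV : #|V| = n) (hreg : regular_graph 3 G) :
  potentially_four_angulable p G.
Proof.
have n_ge4 : (4 <= n)%N by lia.
have [||s [Qs [ps quadQs avoid]]] := @cubic_avoiding_quadrangulation V G (2 + t) hG hreg.
- by lia.
- by rewrite hV -muln2; lia.
have [|sigma [tau [tau_lt tauK sigmaK ccw]]] := ccw_labelling hp; first by lia.
have us : uniq s by rewrite (perm_uniq ps) enum_uniq.
have ms x : x \in s by rewrite (perm_mem ps) mem_enum.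
have ss : size s = n by rewrite (perm_size ps) -cardE.
have idx_lt x : (index x s < n)%N by rewrite -ss index_mem.
have idx_inj x y : index x s = index y s -> x = y.
  by move=> e; rewrite -(nth_index x (ms x)) e nth_index.
have := map_quadrangulation (index^~ s) quadQs.
rewrite map_index_iota // ss => quad_idx.
exists (fun x => sigma (index x s)).
  apply: inj_card_bij; last by rewrite card_ord hV.
  by move=> x y /(congr1 tau); rewrite !sigmaK // => /idx_inj.
pose H : rel 'I_n := fun i j => side_rel (map (map_quad (index^~ s)) Qs) (tau i) (tau j).
have fourH : four_angulation p H.
  exact: (side_rel_four_angulation tau_lt tauK sigmaK ccw n_ge4 quad_idx).
exists H => // i j Hij; apply/andP; split.
  by have [[_ irrH] _ _ _] := fourH; apply: contraTneq Hij => ->; rewrite irrH.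
apply/existsP => -[x /existsP[y /and3P[Gxy /eqP xi /eqP yj]]].
move: Hij; rewrite /H -xi -yj !sigmaK // => /hasP[_ /mapP[Q QQs ->]].
rewrite quad_sides_map => /orP[] /mapP[[x' y'] sideQ] [/idx_inj ex /idx_inj ey].
  by have := avoid _ QQs _ _ sideQ; rewrite -ex -ey Gxy.
have [G_sym _] := hG.
by have := avoid _ QQs _ _ sideQ; rewrite -ex -ey G_sym Gxy.
Qed.
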